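(* Let $G=(V,q)$ be a reversible connected graph with invariant measure $m$ satisfying $CD(0,\infty)$, and suppose that one of the following holds: (A) $\sup_{x\in V}\sum_{y\ne x}q(x,y)<\infty$; (B) $\inf_{x\in V}m(x)>0$ and there exist finitely supported $\eta_k:V\to\mathbb R$ with $\Gamma\eta_k\le 1/k$ and $\eta_k\to1$ pointwise from below; (C) $q(x,y)\le m(y)$ for all $x,y\in V$. Then for every non-negative finitely supported $f:V\to\mathbb R$ and every $t>0$, \[ \|\nabla P_tf\|_\infty\le\frac{\|f\|_\infty}{\sqrt{t\,q_{\min}}}. \] If (A) or (B) holds, this inequality holds for all $f\in\ell_\infty(V)$.
   Context: A graph $G=(V,q)$ consists of a countable set $V$ and a function $q:V\times V\to[0,\infty)$ such that $\#\{y:q(x,y)>0\}<\infty$ for every $x\in V$; its Laplacian is $\Delta f(x)=\sum_y q(x,y)(f(y)-f(x))$. Reversible with invariant measure $m:V\to(0,\infty)$: $q(x,y)m(x)=q(y,x)m(y)$. $d$ is the combinatorial graph distance ($x\sim y$ iff $q(x,y)>0$). $q_{\min}:=\inf\{q(x,y):q(x,y)>0\}$. For $x\ne y$, $\nabla_{xy}f=(f(x)-f(y))/d(x,y)$, $\|\nabla f\|_\infty=\sup_{x\ne y}|\nabla_{xy}f|$. Bakry–Émery: $\Gamma_0(f,g)=fg$, $2\Gamma_{k+1}(f,g)=\Delta\Gamma_k(f,g)-\Gamma_k(f,\Delta g)-\Gamma_k(\Delta f,g)$, $\Gamma=\Gamma_1$, $\Gamma_kf=\Gamma_k(f,f)$;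 $G$ satisfies $CD(0,\infty)$ if $\Gamma_2f\ge0$ for all $f:V\to\mathbb R$. Heat semigroup: for finite $S$ let $q_S(x,y)=q(x,y)1_S(x)$ with Laplacian $\Delta_S$ and $P^S_tf=\sum_{k\ge0}t^k\Delta_S^k(f1_S)/k!$; for bounded $f$, $P_tf=\lim_iP_t^{S_i}f$ pointwise along any increasing exhaustion by finite sets. *)

(* Defs.v *)
From Stdlib Require Import Reals Lra Arith List Classical ClassicalEpsilon.
From Stdlib Require Import Factorial.
Import ListNotations.
Open Scope R_scope.

Section Graphs.
Context {V : Type}.

Definition lsum (l : list V) (F : V -> R) : R :=
  fold_right (fun y acc => F y + acc) 0 l.

(* Graph data: q : V -> V -> R, and N x : list V is the (duplicate-free) list of
   all y with q x y > 0 (local finiteness); hypotheses relating them are in the theorem. *)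

(* Laplacian  Δ g (x) = Σ_y q(x,y) (g y - g x)  (terms with q(x,y)=0 vanish). *)
Definition Lap (N : V -> list V) (q : V -> V -> R) (g : V -> R) (x : V) : R :=
  lsum (N x) (fun y => q x y * (g y - g x)).

Fixpoint Gam (N : V -> list V) (q : V -> V -> R) (k : nat) (f g : V -> R) : V -> R :=
  match k with
  | O => fun x => f x * g x
  | S k' => fun x =>
      (Lap N q (Gam N q k' f g) x - Gam N q k' f (Lap N q g) x
        - Gam N q k' (Lap N q f) g x) / 2
  end.

Definition Gamma N q f := Gam N q 1 f f.
Definition Gamma2 N q f := Gam N q 2 f f.

Definition CD0 N q : Prop := forall (f : V -> R) x, 0 <= Gamma2 N q f x.

Inductive walk (q : V -> V -> R) : V -> V -> nat -> Prop :=
  | walk0 : forall x, walk q x x 0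
  | walkS : forall x y z n, 0 < q x y -> walk q y z n -> walk q x z (S n).

Definition g_connected (q : V -> V -> R) : Prop := forall x y, exists n, walk q x y n.

Definition is_dist (q : V -> V -> R) (x y : V) (n : nat) : Prop :=
  walk q x y n /\ forall k, walk q x y k -> (n <= k)%nat.

Definition is_qmin (q : V -> V -> R) (Q : R) : Prop :=
  (forall x y, 0 < q x y -> Q <= q x y) /\
  (forall Q', (forall x y, 0 < q x y -> Q' <= q x y) -> Q' <= Q).

Definition is_sup_norm (f : V -> R) (M : R) : Prop :=
  is_lub (fun r => exists x, r = Rabs (f x)) M.

Definition bounded_fn (f : V -> R) : Prop := exists B, forall x, Rabs (f x) <= B.

Definition fin_supp (f : V -> R) : Prop :=
  exists L : list V, forall x, ~ In x L -> f x = 0.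

Definition ind (S : list V) (x : V) : R :=
  if excluded_middle_informative (In x S) then 1 else 0.

Definition lim_seq (u : nat -> R) : R :=
  match excluded_middle_informative (exists l, Un_cv u l) with
  | left H => proj1_sig (constructive_indefinite_description _ H)
  | right _ => 0
  end.

(* Δ_S g (x) = 1_S(x) Δ g(x)  (Laplacian of q_S(x,y) = q(x,y) 1_S(x)). *)
Definition LapS N q (S : list V) (g : V -> R) (x : V) : R := ind S x * Lap N q g x.

Fixpoint LapS_iter N q (S : list V) (k : nat) (g : V -> R) : V -> R :=
  match k with
  | O => g
  | S k' => LapS N q S (LapS_iter N q S k' g)
  end.

Definition PS N q (S : list V) (t : R) (f : V -> R) (x : V) : R :=
  lim_seq (fun n => sum_f_R0 (fun k =>
     t ^ k * LapS_iter N q S k (fun y => f y * ind S y) x / INR (fact k)) n).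

Definition exhaustion (Ss : nat -> list V) : Prop :=
  (forall i x, In x (Ss i) -> In x (Ss (S i))) /\ (forall x, exists i, In x (Ss i)).

Definition IsHeat N q (t : R) (f Pf : V -> R) : Prop :=
  forall Ss, exhaustion Ss -> forall x, Un_cv (fun i => PS N q (Ss i) t f x) (Pf x).

(* ||∇ P_t f||_∞ <= ||f||_∞ / sqrt(t q_min), written multiplicatively
   (|∇_{xy} P_t f| * sqrt(t q_min) <= ||f||_∞ for all x ≠ y). *)
Definition heat_grad_bound N q (f : V -> R) (t : R) : Prop :=
  forall Pf, IsHeat N q t f Pf ->
  forall M, is_sup_norm f M ->
  forall Q, is_qmin q Q ->
  forall x y n, x <> y -> is_dist q x y n ->
    Rabs (Pf x - Pf y) / INR n * sqrt (t * Q) <= M.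

Definition condA (N : V -> list V) (q : V -> V -> R) : Prop :=
  exists C, forall x,
    lsum (N x) (fun y => if excluded_middle_informative (y = x) then 0 else q x y) <= C.

(* (B) inf m > 0 and finitely supported η_k with Γη_k ≤ 1/k, η_k → 1 from below
   (index shifted: eta k plays the role of η_{k+1}). *)
Definition condB (N : V -> list V) (q : V -> V -> R) (m : V -> R) : Prop :=
  (exists c, 0 < c /\ forall x, c <= m x) /\
  exists eta : nat -> V -> R,
    (forall k, fin_supp (eta k)) /\
    (forall k x, Gamma N q (eta k) x <= 1 / INR (S k)) /\
    (forall k x, eta k x <= 1) /\
    (forall x, Un_cv (fun k => eta k x) 1).

Definition condC (q : V -> V -> R) (m : V -> R) : Prop :=
  forall x y, q x y <= m y.

End Graphs.

(* Main.v *)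
From Stdlib Require Import Reals Factorial Wf_nat List Lra Lia.
From Stdlib Require Import Classical ClassicalEpsilon FunctionalExtensionality.
From Coquelicot Require Import Coquelicot.
Require Import Defs.
Import ListNotations.
Open Scope R_scope.

(** Along the heat flow u_s = P_s f the function F_s = u_s^2 + 2 s Gamma(u_s) is a
    subsolution of the heat equation: its time derivative is at most Delta F_s because
    Gamma_2 >= 0.  If the maximum principle applies, then F_t <= sup f^2, so that
    t q(x,y) (u_t(x) - u_t(y))^2 <= 2 t Gamma(u_t)(x) <= ||f||^2 on every edge, and the
    gradient bound follows by summing along a path.

    The maximum principle only has to be applied on a finite set, outside of which F is
    already small.  Under (A), F is bounded, and one subtracts eps (d(x0,.) + D s),
    D being the bound on the degree.  Under (B), and under (C) as soon as q_min > 0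
    (then m(z) >= q(y,z) >= q_min for a neighbour y of z), the measure is bounded below.
    For finitely supported f the norm and the energy of u_s decrease in time, and so do
    those of Delta u_s = P_s Delta f; hence u_s^2 + Gamma(u_s) is uniformly summable
    against m and Lipschitz in s, uniformly on V, and so tends to 0 at infinity uniformly
    on [0,t].  Bounded f are reached by monotone approximation.

    The energy estimates are proved for the semigroups of the finite sets S, where they are
    differentiations of finite sums, and passed to the limit. *)

(** * Finite sums over lists, and a criterion for finiteness *)

Section ListSums.
Context {V : Type}.
Implicit Types (l K L : list V) (F G : V -> R).

Lemma lsum_ext l F G :
  (forall y, In y l -> F y = G y) -> lsum l F = lsum l G.
Proof.
  induction l as [|a l IH]; simpl; intros H; auto.
  rewrite IH, H; auto.
Qed.

Lemma lsum_le l F G :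
  (forall y, In y l -> F y <= G y) -> lsum l F <= lsum l G.
Proof.
  induction l as [|a l IH]; simpl; intros H; [lra|].
  apply Rplus_le_compat; auto.
Qed.

Lemma lsum_plus l F G : lsum l (fun y => F y + G y) = lsum l F + lsum l G.
Proof. induction l as [|a l IH]; simpl; [|rewrite IH]; ring. Qed.

Lemma lsum_scal l c F : lsum l (fun y => c * F y) = c * lsum l F.
Proof. induction l as [|a l IH]; simpl; [|rewrite IH]; ring. Qed.

Lemma lsum_minus l F G : lsum l (fun y => F y - G y) = lsum l F - lsum l G.
Proof. induction l as [|a l IH]; simpl; [|rewrite IH]; ring. Qed.

Lemma lsum_zero l F : (forall y, In y l -> F y = 0) -> lsum l F = 0.
Proof.
  induction l as [|a l IH]; simpl; intros H; auto.
  rewrite IH, H; auto; ring.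
Qed.

Lemma lsum_nonneg l F : (forall y, In y l -> 0 <= F y) -> 0 <= lsum l F.
Proof.
  intros H; rewrite <- (lsum_zero l (fun _ => 0)) by auto; now apply lsum_le.
Qed.

Lemma lsum_Rabs l F : Rabs (lsum l F) <= lsum l (fun y => Rabs (F y)).
Proof.
  induction l as [|a l IH]; simpl; [rewrite Rabs_R0; lra|].
  eapply Rle_trans; [apply Rabs_triang|lra].
Qed.

Lemma lsum_term_le l F x :
  (forall y, In y l -> 0 <= F y) -> In x l -> F x <= lsum l F.
Proof.
  induction l as [|a l IH]; simpl; intros H Hx; [tauto|].
  assert (0 <= lsum l F) by (apply lsum_nonneg; auto).
  destruct Hx as [<-|Hx]; [lra|].
  specialize (IH (fun y Hy => H y (or_intror Hy)) Hx).
  specialize (H a (or_introl eq_refl)); lra.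
Qed.

Lemma lsum_swap l K (F : V -> V -> R) :
  lsum l (fun x => lsum K (fun y => F x y)) = lsum K (fun y => lsum l (fun x => F x y)).
Proof.
  induction l as [|a l IH]; simpl.
  - symmetry; apply lsum_zero; auto.
  - rewrite IH, <- lsum_plus; reflexivity.
Qed.

Lemma lsum_cat l K F : lsum (l ++ K) F = lsum l F + lsum K F.
Proof. induction l as [|a l IH]; simpl; [|rewrite IH]; ring. Qed.

(** Induction on [K]: its head is cut out of [l] with [in_split], and [NoDup] keeps it from
    occurring in what remains. *)
Lemma lsum_restrict K l F :
  NoDup K -> NoDup l -> incl K l ->
  (forall x, In x l -> ~ In x K -> F x = 0) -> lsum l F = lsum K F.
Proof.
  revert l; induction K as [|a K IH]; intros l HK Hl Hincl H0.
  - apply lsum_zero; auto.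
  - destruct (in_split a l) as (l1 & l2 & ->); [apply Hincl; left; auto|].
    inversion HK as [|? ? HaK HK']; subst.
    pose proof (NoDup_remove_1 _ _ _ Hl) as Hl'.
    pose proof (NoDup_remove_2 _ _ _ Hl) as Ha.
    rewrite lsum_cat; simpl.
    rewrite <- (IH (l1 ++ l2)); auto.
    + rewrite lsum_cat; ring.
    + intros x Hx.
      assert (Hx' : In x (l1 ++ a :: l2)) by (apply Hincl; right; auto).
      apply in_app_iff in Hx'; apply in_app_iff; simpl in Hx'.
      destruct Hx' as [|[->|]]; tauto.
    + intros x Hx HxK; apply H0.
      * apply in_app_iff; apply in_app_iff in Hx; simpl; tauto.
      * intros [->|]; tauto.
Qed.

Lemma ind_in l x : In x l -> ind l x = 1.
Proof. intros H; unfold ind; destruct excluded_middle_informative; tauto. Qed.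

Lemma ind_notin l x : ~ In x l -> ind l x = 0.
Proof. intros H; unfold ind; destruct excluded_middle_informative; tauto. Qed.

Lemma ind_bounds l x : 0 <= ind l x <= 1.
Proof. unfold ind; destruct excluded_middle_informative; lra. Qed.

Lemma lsum_incl_le K l F :
  NoDup K -> NoDup l -> incl K l -> (forall x, In x l -> 0 <= F x) ->
  lsum K F <= lsum l F.
Proof.
  intros HK Hl Hincl HF.
  rewrite (lsum_ext K F (fun x => ind K x * F x)).
  2:{ intros y Hy; rewrite ind_in; auto; ring. }
  rewrite <- (lsum_restrict K l); auto.
  - apply lsum_le; intros y Hy; pose proof (ind_bounds K y); pose proof (HF y Hy); nra.
  - intros x _ Hx; rewrite ind_notin; auto; ring.
Qed.

Lemma nodup_list_exists l : exists l', NoDup l' /\ forall x, In x l' <-> In x l.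
Proof.
  induction l as [|a l (l' & Hnd & Hin)].
  - exists []; split; [constructor|tauto].
  - destruct (classic (In a l)) as [Ha|Ha].
    + exists l'; split; auto; intros x; rewrite Hin; simpl.
      split; [tauto|intros [<-|]; auto].
    + exists (a :: l'); split.
      * constructor; auto; rewrite Hin; auto.
      * intros x; simpl; rewrite Hin; tauto.
Qed.

(** As long as no list covers [P], a duplicate-free list of points of [P] can be extended by one
    more; at length [n + 1] this contradicts the bound. *)
Lemma finite_of_bounded_nodup (P : V -> Prop) (n : nat) :
  (forall l, NoDup l -> (forall x, In x l -> P x) -> (length l <= n)%nat) ->
  exists l, forall x, P x -> In x l.
Proof.
  intros H.
  assert (Hk : forall k, (exists l, forall x, P x -> In x l) \/
    exists l, NoDup l /\ (forall x, In x l -> P x) /\ length l = k).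
  { induction k as [|k [IH|(l & Hnd & HP & Hlen)]].
    - right; exists []; repeat split; [constructor|simpl; tauto].
    - now left.
    - destruct (classic (exists x, P x /\ ~ In x l)) as [(x & Hx & Hxl)|Hno].
      + right; exists (x :: l); repeat split.
        * now constructor.
        * intros y [<-|Hy]; auto.
        * simpl; lia.
      + left; exists l; intros x Hx; destruct (classic (In x l)); auto.
        exfalso; apply Hno; eauto. }
  destruct (Hk (S n)) as [|(l & Hnd & HP & Hlen)]; auto.
  specialize (H l Hnd HP); lia.
Qed.

Lemma lsum_const_le l c F :
  (forall x, In x l -> c <= F x) -> INR (length l) * c <= lsum l F.
Proof.
  induction l as [|a l IH]; intros H; [simpl; lra|].
  simpl length; rewrite S_INR; simpl lsum.
  pose proof (IH (fun x Hx => H x (or_intror Hx))).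
  pose proof (H a (or_introl eq_refl)); lra.
Qed.

End ListSums.

(** * One-variable calculus: rules of differentiation and consequences of the mean value theorem *)

Section Derivatives.

Lemma is_derive_Rplus (f g : R -> R) x df dg :
  is_derive f x df -> is_derive g x dg -> is_derive (fun s => f s + g s) x (df + dg).
Proof. apply (is_derive_plus f g). Qed.

Lemma is_derive_Rminus (f g : R -> R) x df dg :
  is_derive f x df -> is_derive g x dg -> is_derive (fun s => f s - g s) x (df - dg).
Proof. apply (is_derive_minus f g). Qed.

Lemma is_derive_Rmult (f g : R -> R) x df dg :
  is_derive f x df -> is_derive g x dg ->
  is_derive (fun s => f s * g s) x (df * g x + f x * dg).
Proof. intros; apply (is_derive_mult f g); auto; intros; apply Rmult_comm. Qed.

Lemma is_derive_eq (f : R -> R) (x d d' : R) : is_derive f x d -> d = d' -> is_derive f x d'.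
Proof. now intros H <-. Qed.

Lemma is_derive_Rext (f g : R -> R) x d :
  (forall s, f s = g s) -> is_derive f x d -> is_derive g x d.
Proof. intros H; now apply is_derive_ext. Qed.

Lemma is_derive_lsum {V : Type} (l : list V) (f : V -> R -> R) (df : V -> R) x :
  (forall y, In y l -> is_derive (f y) x (df y)) ->
  is_derive (fun s => lsum l (fun y => f y s)) x (lsum l df).
Proof.
  induction l as [|a l IH]; simpl; intros H.
  - apply (is_derive_const (0 : R)).
  - apply is_derive_Rplus; auto.
Qed.

Lemma is_derive_continuity_pt (f : R -> R) x d : is_derive f x d -> continuity_pt f x.
Proof.
  intros H; apply derivable_continuous_pt; exists d; now apply is_derive_Reals.
Qed.

Lemma derive_bound_lipschitz (f df : R -> R) (B a b : R) :
  0 <= a -> 0 <= b ->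
  (forall s, 0 <= s -> is_derive f s (df s)) ->
  (forall s, 0 <= s -> Rabs (df s) <= B) ->
  Rabs (f b - f a) <= B * Rabs (b - a).
Proof.
  intros Ha Hb Hd HB.
  assert (Hmin : 0 <= Rmin a b) by (apply Rmin_glb; auto).
  destruct (MVT_gen f a b df) as (c & Hc & ->).
  - intros x Hx; apply Hd; lra.
  - intros x Hx; eapply is_derive_continuity_pt, Hd; lra.
  - rewrite Rabs_mult; apply Rmult_le_compat_r; [apply Rabs_pos|apply HB; lra].
Qed.

Lemma derive_nonpos_decreasing (f df : R -> R) (a b : R) :
  a <= b -> (forall s, a <= s <= b -> is_derive f s (df s)) ->
  (forall s, a <= s <= b -> df s <= 0) -> f b <= f a.
Proof.
  intros Hab Hd Hneg.
  destruct (MVT_gen f a b df) as (c & Hc & E).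
  - intros x; rewrite Rmin_left, Rmax_right by auto; intros; apply Hd; lra.
  - intros x; rewrite Rmin_left, Rmax_right by auto.
    intros; eapply is_derive_continuity_pt, Hd; lra.
  - rewrite Rmin_left, Rmax_right in Hc by auto.
    specialize (Hneg c Hc); nra.
Qed.

(** Only earlier times are compared, because in the maximum principle the maximum may sit at the
    final time. *)
Lemma derive_at_left_max (f : R -> R) s d :
  is_derive f s d -> 0 < s -> (forall r, 0 <= r <= s -> f r <= f s) -> 0 <= d.
Proof.
  intros Hd Hs Hmax; apply is_derive_Reals in Hd.
  apply Rnot_lt_le; intros Hneg.
  destruct (Hd (- d / 2)) as (delta & Hdelta); [lra|].
  (* A negative increment: [delta / 2] keeps it inside the differentiability estimate, [s] keeps
     [s + h] nonnegative. *)
  set (h := - Rmin (delta / 2) s).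
  assert (0 < delta) by apply cond_pos.
  assert (0 < Rmin (delta / 2) s) by (apply Rmin_glb_lt; lra).
  assert (Hh : Rmin (delta / 2) s <= delta / 2 /\ Rmin (delta / 2) s <= s)
    by (split; [apply Rmin_l|apply Rmin_r]).
  specialize (Hdelta h); unfold h in *.
  assert (Hq : Rabs ((f (s + - Rmin (delta / 2) s) - f s) / - Rmin (delta / 2) s - d) < - d / 2).
  { apply Hdelta; [lra|]. rewrite Rabs_Ropp, Rabs_right; lra. }
  apply Rabs_def2 in Hq.
  assert (Hf : f (s + - Rmin (delta / 2) s) <= f s) by (apply Hmax; lra).
  assert (0 <= (f (s + - Rmin (delta / 2) s) - f s) / - Rmin (delta / 2) s).
  { replace (_ / _) with ((f s - f (s + - Rmin (delta / 2) s)) / Rmin (delta / 2) s)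
      by (field; lra).
    apply Rmult_le_pos; [lra|left; apply Rinv_0_lt_compat; lra]. }
  lra.
Qed.

End Derivatives.

(** * The Laplacian, Gamma and the maximum principle *)

Section Laplacian.
Context {V : Type} (N : V -> list V) (q : V -> V -> R).
Implicit Types (f g : V -> R) (x y : V).

Lemma Lap_ext f g x : (forall y, f y = g y) -> Lap N q f x = Lap N q g x.
Proof. intros H; apply lsum_ext; intros y _; rewrite !H; reflexivity. Qed.

Lemma Lap_plus f g x : Lap N q (fun y => f y + g y) x = Lap N q f x + Lap N q g x.
Proof. unfold Lap; rewrite <- lsum_plus; apply lsum_ext; intros; ring. Qed.

Lemma Lap_minus f g x : Lap N q (fun y => f y - g y) x = Lap N q f x - Lap N q g x.
Proof. unfold Lap; rewrite <- lsum_minus; apply lsum_ext; intros; ring. Qed.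

Lemma Lap_scal c f x : Lap N q (fun y => c * f y) x = c * Lap N q f x.
Proof. unfold Lap; rewrite <- lsum_scal; apply lsum_ext; intros; ring. Qed.

(** Termwise, [f y * g y - f x * g x] minus the two mixed terms factors as
    [(f y - f x) * (g y - g x)]. *)
Lemma Gam1_eq f g x :
  Gam N q 1 f g x = lsum (N x) (fun y => q x y * ((f y - f x) * (g y - g x))) / 2.
Proof.
  simpl; unfold Lap; f_equal.
  rewrite (Rmult_comm (lsum (N x) (fun y => q x y * (f y - f x)))).
  rewrite <- !lsum_scal, <- !lsum_minus.
  apply lsum_ext; intros; ring.
Qed.

Lemma Gamma_eq f x :
  Gamma N q f x = lsum (N x) (fun y => q x y * ((f y - f x) * (f y - f x))) / 2.
Proof. apply Gam1_eq. Qed.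

Lemma Gam1_sym f g x : Gam N q 1 f g x = Gam N q 1 g f x.
Proof. rewrite !Gam1_eq; f_equal; apply lsum_ext; intros; ring. Qed.

Lemma Lap_sqr f x :
  Lap N q (fun y => f y * f y) x = 2 * (f x * Lap N q f x) + 2 * Gamma N q f x.
Proof. unfold Gamma; simpl; field. Qed.

(** The symmetry of [Gam N q 1] merges the two mixed terms. In this form [Gam N q 1 f (Lap N q f)]
    is the term that the time derivative of [Gamma] along the flow produces. *)
Lemma Gamma2_eq f x :
  Gamma2 N q f x = Lap N q (Gamma N q f) x / 2 - Gam N q 1 f (Lap N q f) x.
Proof.
  change (Gamma2 N q f x) with
    ((Lap N q (Gamma N q f) x - Gam N q 1 f (Lap N q f) x
      - Gam N q 1 (Lap N q f) f x) / 2).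
  rewrite (Gam1_sym (Lap N q f)); field.
Qed.

Lemma is_derive_Lap (u du : R -> V -> R) (s : R) x :
  (forall y, is_derive (fun r => u r y) s (du s y)) ->
  is_derive (fun r => Lap N q (u r) x) s (Lap N q (du s) x).
Proof.
  intros H; unfold Lap.
  apply (is_derive_lsum (N x) (fun y r => q x y * (u r y - u r x))).
  intros y _; apply is_derive_scal, is_derive_Rminus; auto.
Qed.

Lemma is_derive_Gamma (u du : R -> V -> R) (s : R) x :
  (forall y, is_derive (fun r => u r y) s (du s y)) ->
  is_derive (fun r => Gamma N q (u r) x) s (2 * Gam N q 1 (u s) (du s) x).
Proof.
  intros H.
  apply (is_derive_Rext (fun r => / 2 * lsum (N x) (fun y =>
           q x y * ((u r y - u r x) * (u r y - u r x))))).
  { intros r; rewrite Gamma_eq; field. }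
  eapply is_derive_eq.
  - apply is_derive_scal.
    apply (is_derive_lsum (N x) (fun y r => q x y * ((u r y - u r x) * (u r y - u r x)))).
    intros y _; apply is_derive_scal, is_derive_Rmult; apply is_derive_Rminus; apply H.
  - rewrite Gam1_eq.
    replace (2 * (_ / 2)) with
      (/ 2 * (2 * lsum (N x) (fun y => q x y * ((u s y - u s x) * (du s y - du s x)))))
      by field.
    rewrite <- !lsum_scal; apply lsum_ext; intros y _; simpl; ring.
Qed.

Lemma continuity_pt_lsum (l : list V) (F : V -> R -> R) s :
  (forall y, In y l -> continuity_pt (F y) s) ->
  continuity_pt (fun r => lsum l (fun y => F y r)) s.
Proof.
  induction l as [|a l IH]; simpl; intros H.
  - apply continuity_pt_const; intros ? ?; reflexivity.
  - apply (continuity_pt_plus (F a) (fun r => lsum l (fun y => F y r))); auto.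
Qed.

Lemma continuity_pt_Gamma (u : R -> V -> R) s x :
  (forall y, continuity_pt (fun r => u r y) s) ->
  continuity_pt (fun r => Gamma N q (u r) x) s.
Proof.
  intros H.
  apply continuity_pt_ext with (fun r => lsum (N x) (fun y =>
           / 2 * (q x y * ((u r y - u r x) * (u r y - u r x))))).
  { intros r; rewrite Gamma_eq, lsum_scal; field. }
  apply (continuity_pt_lsum (N x) (fun y r =>
           / 2 * (q x y * ((u r y - u r x) * (u r y - u r x))))).
  intros y _.
  assert (D : continuity_pt (fun r => u r y - u r x) s)
    by (apply (continuity_pt_minus (fun r => u r y) (fun r => u r x)); auto).
  apply continuity_pt_scal, continuity_pt_scal.
  apply (continuity_pt_mult (fun r => u r y - u r x) (fun r => u r y - u r x)); auto.
Qed.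

Context (Hq : forall x y, 0 <= q x y).

Lemma Gamma_nonneg f x : 0 <= Gamma N q f x.
Proof.
  rewrite Gamma_eq; apply Rmult_le_pos; [|lra].
  apply lsum_nonneg; intros y _; apply Rmult_le_pos; auto; apply Rle_0_sqr.
Qed.

(** Termwise this is [|a b| <= (a^2 + b^2) / 2]. *)
Lemma Gam1_bound f g x : Rabs (2 * Gam N q 1 f g x) <= Gamma N q f x + Gamma N q g x.
Proof.
  rewrite !Gamma_eq, Gam1_eq.
  replace (2 * (lsum (N x) (fun y => q x y * ((f y - f x) * (g y - g x))) / 2))
    with (lsum (N x) (fun y => q x y * ((f y - f x) * (g y - g x)))) by field.
  eapply Rle_trans; [apply lsum_Rabs|].
  rewrite <- Rdiv_plus_distr, <- lsum_plus.
  unfold Rdiv; rewrite Rmult_comm, <- lsum_scal; apply lsum_le; intros y _.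
  rewrite Rabs_mult, (Rabs_right (q x y)) by (apply Rle_ge; auto).
  rewrite <- Rmult_plus_distr_l, <- Rmult_assoc, (Rmult_comm (/ 2)), Rmult_assoc.
  apply Rmult_le_compat_l; auto.
  apply Rabs_le; split.
  - pose proof (Rle_0_sqr ((f y - f x) + (g y - g x))); unfold Rsqr in *; lra.
  - pose proof (Rle_0_sqr ((f y - f x) - (g y - g x))); unfold Rsqr in *; lra.
Qed.

Lemma Lap_nonpos_at_max f x : (forall y, f y <= f x) -> Lap N q f x <= 0.
Proof.
  intros H; unfold Lap; rewrite <- (lsum_zero (N x) (fun _ => 0)) by auto.
  apply lsum_le; intros y _; specialize (H y); specialize (Hq x y); nra.
Qed.

Lemma Lap_bound f x B :
  (forall y, Rabs (f y) <= B) -> Rabs (Lap N q f x) <= 2 * B * lsum (N x) (q x).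
Proof.
  intros H; eapply Rle_trans; [apply lsum_Rabs|].
  rewrite <- lsum_scal; apply lsum_le; intros y _.
  rewrite Rabs_mult, (Rabs_right (q x y)) by (apply Rle_ge; auto).
  rewrite Rmult_comm; apply Rmult_le_compat_r; auto.
  pose proof (H x) as H1; pose proof (H y) as H2.
  apply Rabs_le_between in H1; apply Rabs_le_between in H2; apply Rabs_le; lra.
Qed.

Lemma space_time_max_exists (K : list V) (T : R) (w : R -> V -> R) :
  K <> [] -> 0 <= T ->
  (forall x s, In x K -> 0 <= s <= T -> continuity_pt (fun r => w r x) s) ->
  exists s0 x0, In x0 K /\ 0 <= s0 <= T /\
    forall x s, In x K -> 0 <= s <= T -> w s x <= w s0 x0.
Proof.
  induction K as [|a K IH]; [tauto|intros _ HT Hc].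
  destruct (continuity_ab_maj (fun r => w r a) 0 T HT) as (sa & Hsa & Hsa').
  { intros s Hs; apply Hc; [left|]; auto. }
  destruct K as [|b K].
  - exists sa, a; split; [left; auto|split; auto].
    intros x s [<-|[]] Hs; auto.
  - destruct IH as (s0 & x0 & Hx0 & Hs0 & Hmax); [discriminate|auto| |].
    { intros x s Hx Hs; apply Hc; [right|]; auto. }
    destruct (Rle_lt_dec (w s0 x0) (w sa a)).
    + exists sa, a; split; [left; auto|split; auto].
      intros x s [<-|Hx] Hs; auto; specialize (Hmax x s Hx Hs); lra.
    + exists s0, x0; split; [right; auto|split; auto].
      intros x s [<-|Hx] Hs; auto; specialize (Hsa s Hs); lra.
Qed.

(** Subtracting [d * s] makes the subsolution strict. If [w] had a space-time maximum over [K] above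
    [c], it would be a spatial maximum over all of [V], since [w <= c] outside [K]; there the time
    derivative is nonnegative and the Laplacian nonpositive, a contradiction. Differentiability is
    asked only for [s > 0], which is what [heat_derive] provides. *)
Lemma max_principle (K : list V) (T c : R) (z dz : R -> V -> R) :
  (forall x s, In x K -> 0 <= s <= T -> continuity_pt (fun r => z r x) s) ->
  (forall x s, In x K -> 0 < s <= T -> is_derive (fun r => z r x) s (dz s x)) ->
  (forall x s, In x K -> 0 < s <= T -> dz s x <= Lap N q (z s) x) ->
  (forall x, In x K -> z 0 x <= c) ->
  (forall x s, ~ In x K -> 0 <= s <= T -> z s x <= c) ->
  forall x s, 0 <= s <= T -> z s x <= c.
Proof.
  intros Hcont Hder Hsub H0 Hout x1 s1 Hs1.
  destruct (classic (In x1 K)) as [Hx1|]; [|auto].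
  apply le_epsilon; intros e He.
  (* This slope makes the total correction [d * s1] at most [e] for [s1 <= T]. *)
  set (d := e / (T + 1)).
  assert (Hd : 0 < d) by (apply Rdiv_lt_0_compat; lra).
  set (w := fun r x => z r x - d * r).
  destruct (space_time_max_exists K T w) as (s0 & x0 & Hx0 & Hs0 & Hmax).
  - intros ->; destruct Hx1.
  - lra.
  - intros x s Hx Hs; apply (continuity_pt_minus (fun r => z r x) (fun r => d * r)); auto.
    apply continuity_pt_scal, continuity_pt_id.
  - assert (Hw : w s0 x0 <= c).
    { apply Rnot_lt_le; intros Hlt.
      assert (Hs0' : 0 < s0).
      { destruct (Req_dec s0 0) as [->|]; [|lra].
        unfold w in Hlt; specialize (H0 x0 Hx0); lra. }
      assert (Hglob : forall y, w s0 y <= w s0 x0).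
      { intros y; destruct (classic (In y K)) as [Hy|Hy]; auto.
        specialize (Hout y s0 Hy Hs0); unfold w in *; nra. }
      assert (Hge : 0 <= dz s0 x0 - d * 1).
      { apply (derive_at_left_max (fun r => w r x0) s0); auto.
        - unfold w; apply is_derive_Rminus; [apply Hder; auto; lra|].
          apply is_derive_scal, (is_derive_id (s0 : R)).
        - intros r Hr; apply Hmax; auto; lra. }
      assert (Hle : Lap N q (w s0) x0 <= 0) by (apply Lap_nonpos_at_max; auto).
      unfold w in Hle; rewrite Lap_minus in Hle.
      replace (Lap N q (fun _ => d * s0) x0) with 0 in Hle
        by (symmetry; apply lsum_zero; intros; ring).
      specialize (Hsub x0 s0 Hx0 (conj Hs0' (proj2 Hs0))); lra. }
    specialize (Hmax x1 s1 Hx1 Hs1); unfold w in *.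
    assert (d * s1 <= e).
    { replace e with (d * (T + 1)) by (unfold d; field; lra).
      apply Rmult_le_compat_l; lra. }
    lra.
Qed.

End Laplacian.

(** * The semigroup of a finite set *)

Lemma exp_series_bounded (y : R) : exists B, forall n, Rabs (y ^ n / INR (fact n)) <= B.
Proof.
  destruct (maj_by_pos (fun n => y ^ n / INR (fact n))) as (B & _ & HB).
  - exists 0; apply cv_speed_pow_fact.
  - exists B; auto.
Qed.

(** At radius [|s| + 1] the terms are dominated by [B * (C * r)^n / n!], which is a bounded
    sequence; so the radius of convergence strictly exceeds [|s|]. *)
Lemma CV_radius_exp_type (a : nat -> R) (B C : R) (s : R) :
  0 <= B -> 0 <= C -> (forall n, Rabs (a n) <= B * C ^ n) ->
  Rbar_lt (Rabs s) (CV_radius (fun n => a n / INR (fact n))).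
Proof.
  intros HB HC Ha.
  apply Rbar_lt_le_trans with (Rabs s + 1); [simpl; lra|].
  apply (proj1 (CV_radius_bounded (fun n => a n / INR (fact n)))).
  set (r := Rabs s + 1).
  assert (Hr : 0 <= r) by (pose proof (Rabs_pos s); unfold r; lra).
  destruct (exp_series_bounded (C * r)) as (M & HM).
  exists (B * M); intros n.
  apply Rle_trans with (B * Rabs ((C * r) ^ n / INR (fact n))).
  2:{ apply Rmult_le_compat_l; auto. }
  pose proof (INR_fact_lt_0 n) as Hf.
  rewrite Rpow_mult_distr; unfold Rdiv; rewrite !Rabs_mult.
  rewrite (Rabs_right (C ^ n)) by (apply Rle_ge, pow_le; auto).
  pose proof (Rabs_pos (/ INR (fact n))); pose proof (Rabs_pos (r ^ n)).
  replace (Rabs (a n) * Rabs (/ INR (fact n)) * Rabs (r ^ n)) with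
    (Rabs (a n) * (Rabs (/ INR (fact n)) * Rabs (r ^ n))) by ring.
  replace (B * _) with (B * C ^ n * (Rabs (/ INR (fact n)) * Rabs (r ^ n))) by ring.
  apply Rmult_le_compat_r; auto; nra.
Qed.

Lemma is_series_Rext (a b : nat -> R) (l : R) :
  (forall n, a n = b n) -> is_series a l -> is_series b l.
Proof. apply is_series_ext. Qed.

Lemma is_series_Rscal (c : R) (a : nat -> R) (l : R) :
  is_series a l -> is_series (fun k => c * a k) (c * l).
Proof. apply (is_series_scal c a l). Qed.

Lemma is_series_Rminus (a b : nat -> R) (la lb : R) :
  is_series a la -> is_series b lb -> is_series (fun k => a k - b k) (la - lb).
Proof. apply (is_series_minus a b la lb). Qed.

Lemma is_series_lsum {V : Type} (l : list V) (a : V -> nat -> R) (L : V -> R) :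
  (forall y, In y l -> is_series (a y) (L y)) ->
  is_series (fun k => lsum l (fun y => a y k)) (lsum l L).
Proof.
  induction l as [|z l IH]; simpl; intros H.
  - apply (filterlim_ext (fun _ => 0)); [|apply filterlim_const].
    intros n; rewrite sum_n_const, Rmult_0_r; reflexivity.
  - apply (is_series_plus (a z) (fun k => lsum l (fun y => a y k))); auto.
Qed.

Lemma lim_seq_eq (u : nat -> R) (l : R) : Un_cv u l -> lim_seq u = l.
Proof.
  intros H; unfold lim_seq; destruct excluded_middle_informative as [He|He].
  - destruct constructive_indefinite_description as (l' & Hl'); simpl.
    eapply UL_sequence; eauto.
  - exfalso; eauto.
Qed.

Section FiniteSemigroup.
Context {V : Type} (N : V -> list V) (q : V -> V -> R) (Hq : forall x y, 0 <= q x y).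
Implicit Types (f g : V -> R) (x y : V) (S : list V).

Lemma LapS_in S g x : In x S -> LapS N q S g x = Lap N q g x.
Proof. intros H; unfold LapS; rewrite ind_in by auto; ring. Qed.

Lemma LapS_notin S g x : ~ In x S -> LapS N q S g x = 0.
Proof. intros H; unfold LapS; rewrite ind_notin by auto; ring. Qed.

(** The sum over [S] of the total rates bounds each of them, so [LapS] is a bounded operator on
    bounded functions, whatever the rates outside [S]. *)
Lemma LapS_bound S g B x :
  0 <= B -> (forall y, Rabs (g y) <= B) ->
  Rabs (LapS N q S g x) <= 2 * lsum S (fun z => lsum (N z) (q z)) * B.
Proof.
  intros HB Hg.
  assert (Hpos : forall z, 0 <= lsum (N z) (q z)) by (intros; apply lsum_nonneg; auto).
  destruct (classic (In x S)) as [Hx|Hx].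
  - rewrite LapS_in by auto.
    eapply Rle_trans; [apply Lap_bound; eauto|].
    pose proof (lsum_term_le S (fun z => lsum (N z) (q z)) x (fun z _ => Hpos z) Hx); nra.
  - rewrite LapS_notin, Rabs_R0 by auto.
    pose proof (lsum_nonneg S (fun z => lsum (N z) (q z)) (fun z _ => Hpos z)); nra.
Qed.

Lemma LapS_iter_bound S g B k x :
  0 <= B -> (forall y, Rabs (g y) <= B) ->
  Rabs (LapS_iter N q S k g x) <= B * (2 * lsum S (fun z => lsum (N z) (q z))) ^ k.
Proof.
  intros HB Hg; revert x; induction k as [|k IH]; intros x; simpl.
  - rewrite Rmult_1_r; auto.
  - set (C := 2 * lsum S (fun z => lsum (N z) (q z))) in *.
    replace (B * (C * C ^ k)) with (C * (B * C ^ k)) by ring.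
    apply LapS_bound; auto.
    eapply Rle_trans; [apply Rabs_pos|apply (IH x)].
Qed.

(** The same exponential series as [PS], as a power series in [s], so that it can be differentiated
    term by term. *)
Definition heatS S f (s : R) x : R :=
  PSeries (fun k => LapS_iter N q S k (fun y => f y * ind S y) x / INR (fact k)) s.

Lemma cutoff_bound S f B :
  (forall y, Rabs (f y) <= B) -> forall y, Rabs (f y * ind S y) <= B.
Proof.
  intros Hf y; rewrite Rabs_mult; pose proof (ind_bounds S y).
  rewrite (Rabs_right (ind S y)) by lra.
  pose proof (Hf y); pose proof (Rabs_pos (f y)); nra.
Qed.

Lemma heatS_radius S f x (s : R) : bounded_fn f ->
  Rbar_lt (Rabs s) (CV_radius (fun k =>
    LapS_iter N q S k (fun y => f y * ind S y) x / INR (fact k))).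
Proof.
  intros (B & HB).
  assert (HB0 : 0 <= B) by (eapply Rle_trans; [apply Rabs_pos|apply (HB x)]).
  apply CV_radius_exp_type with B (2 * lsum S (fun z => lsum (N z) (q z))); auto.
  - apply Rmult_le_pos; [lra|]; apply lsum_nonneg; intros; apply lsum_nonneg; auto.
  - intros n; apply LapS_iter_bound; auto; now apply cutoff_bound.
Qed.

Lemma heatS_series S f x s : bounded_fn f ->
  is_series (fun k => LapS_iter N q S k (fun y => f y * ind S y) x / INR (fact k) * s ^ k)
    (heatS S f s x).
Proof.
  intros Hf.
  refine (proj1 (is_pseries_R _ _ _) _).
  apply PSeries_correct, CV_radius_inside.
  now apply heatS_radius.
Qed.

Lemma PS_heatS S t f x : bounded_fn f -> PS N q S t f x = heatS S f t x.
Proof.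
  intros Hf; apply lim_seq_eq.
  apply (is_series_Reals (fun k =>
     t ^ k * LapS_iter N q S k (fun y => f y * ind S y) x / INR (fact k))).
  eapply is_series_Rext; [|apply heatS_series; auto].
  intros n; simpl; unfold Rdiv; ring.
Qed.

Lemma heatS_0 S f x : heatS S f 0 x = f x * ind S x.
Proof. unfold heatS; rewrite PSeries_0; simpl; field. Qed.

Lemma heatS_notin S f s x : ~ In x S -> heatS S f s x = 0.
Proof.
  intros Hx; unfold heatS.
  rewrite (PSeries_ext _ (fun _ => 0)); [apply PSeries_const_0|].
  intros [|k]; simpl; [rewrite ind_notin by auto|rewrite LapS_notin by auto];
    unfold Rdiv; ring.
Qed.

(** Differentiating shifts the coefficients, which amounts to applying [LapS] to each of them;
    [LapS] is a finite sum at [x] and so commutes with the series. *)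
Lemma heatS_derive S f (s : R) x : bounded_fn f ->
  is_derive (fun r => heatS S f r x) s (LapS N q S (heatS S f s) x).
Proof.
  intros Hf; eapply is_derive_eq.
  - apply (is_derive_PSeries (fun k =>
      LapS_iter N q S k (fun y => f y * ind S y) x / INR (fact k))).
    now apply heatS_radius.
  - apply is_pseries_unique, is_pseries_R.
    set (h := LapS_iter N q S).
    apply (is_series_Rext (fun k => ind S x * lsum (N x) (fun y => q x y *
       (h k (fun y => f y * ind S y) y / INR (fact k) * s ^ k
        - h k (fun y => f y * ind S y) x / INR (fact k) * s ^ k)))).
    { intros k.
      assert (Hk : INR (fact k) <> 0) by apply INR_fact_neq_0.
      unfold PS_derive.
      (* The factor [k + 1] turns [1 / (k + 1)!] into [1 / k!]. *)
      replace (INR (Datatypes.S k) *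
        (h (Datatypes.S k) (fun y => f y * ind S y) x / INR (fact (Datatypes.S k))))
        with (LapS N q S (h k (fun y => f y * ind S y)) x / INR (fact k)).
      2:{ rewrite fact_simpl, mult_INR; 
          change (h (Datatypes.S k) (fun y => f y * ind S y) x)
            with (LapS N q S (h k (fun y => f y * ind S y)) x).
          generalize (LapS N q S (h k (fun y => f y * ind S y)) x); intros a.
          field; split; [auto|apply not_0_INR; lia]. }
      transitivity (ind S x * (/ INR (fact k) * s ^ k *
        Lap N q (h k (fun y => f y * ind S y)) x)).
      - f_equal; unfold Lap; rewrite <- lsum_scal; apply lsum_ext.
        intros y _; unfold Rdiv; ring.
      - unfold LapS, Rdiv; ring. }
    unfold LapS; apply is_series_Rscal.
    apply (is_series_lsum (N x) (fun y k => q x y *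
       (h k (fun y => f y * ind S y) y / INR (fact k) * s ^ k
        - h k (fun y => f y * ind S y) x / INR (fact k) * s ^ k))).
    intros y _; apply is_series_Rscal, is_series_Rminus; now apply heatS_series.
Qed.

(** The heat equation on [S] with Dirichlet condition outside. Comparison and energy arguments are
    stated for such [u] so that they apply to differences and to [LapS] of a solution as well. *)
Definition solS S (u : R -> V -> R) : Prop :=
  (forall s x, is_derive (fun r => u r x) s (LapS N q S (u s) x)) /\
  (forall s x, ~ In x S -> u s x = 0).

Lemma solS_heatS S f : bounded_fn f -> solS S (heatS S f).
Proof.
  intros Hf; split; intros; [now apply heatS_derive|now apply heatS_notin].
Qed.

Lemma solS_minus S u v : solS S u -> solS S v -> solS S (fun s x => u s x - v s x).
Proof.
  intros (Hu & Hu0) (Hv & Hv0); split; intros s x.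
  - unfold LapS; rewrite Lap_minus, Rmult_minus_distr_l.
    apply is_derive_Rminus; [apply Hu|apply Hv].
  - intros Hx; rewrite Hu0, Hv0; auto; ring.
Qed.

Lemma solS_scal S c u : solS S u -> solS S (fun s x => c * u s x).
Proof.
  intros (Hu & Hu0); split; intros s x.
  - unfold LapS; rewrite Lap_scal, <- Rmult_assoc, (Rmult_comm (ind S x)), Rmult_assoc.
    apply is_derive_scal, Hu.
  - intros Hx; rewrite Hu0; auto; ring.
Qed.

(** The time derivative of a solution is a solution, so every energy estimate also holds for it. *)
Lemma solS_LapS S u : solS S u -> solS S (fun s => LapS N q S (u s)).
Proof.
  intros (Hu & Hu0); split; intros s x.
  - unfold LapS at 1 2; apply is_derive_scal.
    apply (is_derive_Lap N q u (fun s => LapS N q S (u s))); auto.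
  - intros Hx; now apply LapS_notin.
Qed.

(** Domain monotonicity: on [S] both operators are [Lap], and outside [S] the difference [u - v]
    equals [- v <= 0]. *)
Lemma solS_mono S S' u v :
  incl S S' -> solS S u -> solS S' v ->
  (forall x, In x S -> u 0 x <= v 0 x) -> (forall s x, 0 <= s -> 0 <= v s x) ->
  forall s x, 0 <= s -> u s x <= v s x.
Proof.
  intros Hincl (Hu & Hu0) (Hv & Hv0) H0 Hpos s x Hs.
  assert (Hd : forall r y, is_derive (fun r => u r y - v r y) r
    (LapS N q S (u r) y - LapS N q S' (v r) y)).
  { intros r y; apply is_derive_Rminus; auto. }
  enough (u s x - v s x <= 0) by lra.
  apply (max_principle N q Hq S s 0 (fun r y => u r y - v r y)
    (fun r y => LapS N q S (u r) y - LapS N q S' (v r) y)); try lra.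
  - intros y r _ _; eapply is_derive_continuity_pt, Hd.
  - intros y r _ _; apply Hd.
  - intros y r Hy _; rewrite Lap_minus, !LapS_in; auto; lra.
  - intros y Hy; specialize (H0 y Hy); lra.
  - intros y r Hy Hr; rewrite Hu0 by auto; specialize (Hpos r y (proj1 Hr)); lra.
Qed.

Lemma solS_le S u c :
  0 <= c -> solS S u -> (forall x, In x S -> u 0 x <= c) ->
  forall s x, 0 <= s -> u s x <= c.
Proof.
  intros Hc (Hu & Hu0) H0 s x Hs.
  apply (max_principle N q Hq S s c u (fun r => LapS N q S (u r))); try lra; auto.
  - intros y r _ _; eapply is_derive_continuity_pt, Hu.
  - intros y r Hy _; rewrite LapS_in by auto; lra.
  - intros y r Hy _; rewrite Hu0; auto.
Qed.

Lemma solS_abs S u B :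
  0 <= B -> solS S u -> (forall x, In x S -> Rabs (u 0 x) <= B) ->
  forall s x, 0 <= s -> Rabs (u s x) <= B.
Proof.
  intros HB Hu H0 s x Hs; apply Rabs_le; split.
  - enough (-1 * u s x <= B) by lra.
    apply (solS_le S (fun s x => -1 * u s x)); auto using solS_scal.
    intros y Hy; specialize (H0 y Hy); apply Rabs_le_between in H0; lra.
  - apply (solS_le S u); auto.
    intros y Hy; specialize (H0 y Hy); apply Rabs_le_between in H0; lra.
Qed.

Lemma solS_nonneg S u :
  solS S u -> (forall x, In x S -> 0 <= u 0 x) -> forall s x, 0 <= s -> 0 <= u s x.
Proof.
  intros Hu H0 s x Hs; enough (-1 * u s x <= 0) by lra.
  apply (solS_le S (fun s x => -1 * u s x)); auto using solS_scal; [lra|].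
  intros y Hy; specialize (H0 y Hy); lra.
Qed.

Lemma solS_unique S u v :
  solS S u -> solS S v -> (forall x, In x S -> u 0 x = v 0 x) ->
  forall s x, 0 <= s -> u s x = v s x.
Proof.
  intros Hu Hv H0 s x Hs.
  assert (Rabs (u s x - v s x) <= 0).
  { apply (solS_abs S (fun s x => u s x - v s x)); auto using solS_minus; [lra|].
    intros y Hy; rewrite H0, Rminus_diag, Rabs_R0 by auto; lra. }
  pose proof (Rabs_pos (u s x - v s x)).
  apply Rminus_diag_uniq; destruct (Req_dec (u s x - v s x) 0) as [|Hne]; auto.
  apply Rabs_no_R0 in Hne; lra.
Qed.

End FiniteSemigroup.

(** * Energy estimates *)

Section Energy.
Context {V : Type} (N : V -> list V) (q : V -> V -> R) (m : V -> R).
Context (Hq : forall x y, 0 <= q x y) (HN : forall x y, In y (N x) <-> 0 < q x y).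
Context (HNd : forall x, NoDup (N x)) (Hm : forall x, 0 < m x).
Context (Hrev : forall x y, q x y * m x = q y x * m y).
Implicit Types (f g h : V -> R) (x y : V) (S W K : list V).

Lemma lsum_neighbors W x (F : V -> R) :
  NoDup W -> incl (N x) W ->
  lsum (N x) (fun y => q x y * F y) = lsum W (fun y => q x y * F y).
Proof.
  intros HW Hincl; symmetry; apply lsum_restrict; auto.
  intros y _ Hy; rewrite HN in Hy; specialize (Hq x y).
  replace (q x y) with 0 by lra; ring.
Qed.

(** Green's formula. [W] contains [S] and its neighbours, so that both sums can run over [W]. *)
Lemma green S W g h :
  NoDup S -> NoDup W -> incl S W -> (forall x, In x S -> incl (N x) W) ->
  (forall x, ~ In x S -> h x = 0) ->
  lsum S (fun x => m x * (h x * Lap N q g x)) =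
  - / 2 * lsum W (fun x => m x *
            lsum W (fun y => q x y * ((h y - h x) * (g y - g x)))).
Proof.
  intros HS HW HSW HNW Hh.
  set (A := lsum W (fun x => lsum W (fun y => q x y * m x * (h x * (g y - g x))))).
  assert (EA : lsum S (fun x => m x * (h x * Lap N q g x)) = A).
  { rewrite <- (lsum_restrict S W); auto.
    2:{ intros x _ Hx; rewrite Hh by auto; ring. }
    apply lsum_ext; intros x _; destruct (classic (In x S)) as [Hx|Hx].
    - unfold Lap; rewrite (lsum_neighbors W x) by auto.
      rewrite <- !lsum_scal; apply lsum_ext; intros; ring.
    - rewrite Hh by auto; rewrite lsum_zero; [ring|intros; ring]. }
  (* The summation variables are exchanged and reversibility moves the weight; adding both
     expressions for [A] symmetrizes the sum. *)
  assert (EB : A = lsum W (fun x => lsum W (fun y => q x y * m x * (h y * (g x - g y))))).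
  { unfold A; rewrite lsum_swap; apply lsum_ext; intros x _.
    apply lsum_ext; intros y _; rewrite Hrev; ring. }
  rewrite EA.
  enough (2 * A = - lsum W (fun x => m x *
            lsum W (fun y => q x y * ((h y - h x) * (g y - g x))))) by lra.
  replace (2 * A) with (A + A) by ring; rewrite EB at 2; unfold A.
  rewrite <- lsum_plus.
  replace (- lsum W _) with (-1 * lsum W (fun x => m x *
            lsum W (fun y => q x y * ((h y - h x) * (g y - g x))))) by ring.
  rewrite <- lsum_scal; apply lsum_ext; intros x _.
  rewrite <- lsum_plus, <- !lsum_scal; apply lsum_ext; intros; ring.
Qed.

Lemma lsum_Lap_sym S g h :
  NoDup S -> (forall x, ~ In x S -> g x = 0) -> (forall x, ~ In x S -> h x = 0) ->
  lsum S (fun x => m x * (h x * Lap N q g x)) = lsum S (fun x => m x * (g x * Lap N q h x)).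
Proof.
  intros HS Hg Hh.
  destruct (nodup_list_exists (S ++ flat_map N S)) as (W & HW & HinW).
  assert (HSW : incl S W) by (intros x Hx; apply HinW, in_or_app; auto).
  assert (HNW : forall x, In x S -> incl (N x) W).
  { intros x Hx y Hy; apply HinW, in_or_app; right; apply in_flat_map; eauto. }
  rewrite !(green S W) by auto; f_equal.
  apply lsum_ext; intros x _; f_equal; apply lsum_ext; intros; ring.
Qed.

Definition norm2 S g : R := lsum S (fun x => m x * (g x * g x)).
(** For [g] vanishing outside [S] this is the total of [m * Gamma g] over [V], including the
    neighbours of [S]; the form [- <g, Lap g>] needs only a sum over [S]. *)
Definition energy S g : R := - lsum S (fun x => m x * (g x * Lap N q g x)).

Lemma norm2_sum_le S K g :
  NoDup S -> NoDup K -> (forall x, ~ In x S -> g x = 0) ->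
  lsum K (fun x => m x * (g x * g x)) <= norm2 S g.
Proof.
  intros HS HK Hg; unfold norm2.
  destruct (nodup_list_exists (S ++ K)) as (W & HW & HinW).
  assert (HSW : incl S W) by (intros x Hx; apply HinW, in_or_app; auto).
  assert (HKW : incl K W) by (intros x Hx; apply HinW, in_or_app; auto).
  rewrite <- (lsum_restrict S W); auto.
  - apply lsum_incl_le; auto; intros x _.
    apply Rmult_le_pos; [left; auto|apply Rle_0_sqr].
  - intros x _ Hx; rewrite Hg; auto; ring.
Qed.

(** By [green] on a [W] that also contains [K] and its neighbours, the energy is a sum of
    nonnegative terms, and those with [x] in [K] are [m x * Gamma N q g x]. *)
Lemma energy_sum_le S K g :
  NoDup S -> NoDup K -> (forall x, ~ In x S -> g x = 0) ->
  lsum K (fun x => m x * Gamma N q g x) <= energy S g.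
Proof.
  intros HS HK Hg; unfold energy.
  destruct (nodup_list_exists (S ++ flat_map N S ++ K ++ flat_map N K)) as (W & HW & HinW).
  assert (HW' : forall x, In x S \/ In x (flat_map N S) \/ In x K \/ In x (flat_map N K)
    -> In x W) by (intros x Hx; apply HinW; rewrite !in_app_iff; tauto).
  assert (HNS : forall x, In x S -> incl (N x) W).
  { intros x Hx y Hy; apply HW'; right; left; apply in_flat_map; eauto. }
  assert (HNK : forall x, In x K -> incl (N x) W).
  { intros x Hx y Hy; apply HW'; do 3 right; apply in_flat_map; eauto. }
  rewrite (green S W); auto; [|intros x Hx; apply HW'; auto].
  replace (- (- / 2 * _)) with (/ 2 * lsum W (fun x => m x *
            lsum W (fun y => q x y * ((g y - g x) * (g y - g x))))) by ring.
  rewrite <- lsum_scal.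
  eapply Rle_trans; [|apply (lsum_incl_le K W)]; auto.
  - right; apply lsum_ext; intros x Hx; rewrite Gamma_eq.
    rewrite (lsum_neighbors W x) by auto; field.
  - intros x Hx; apply HW'; auto.
  - intros x _; apply Rmult_le_pos; [lra|]; apply Rmult_le_pos; [left; auto|].
    apply lsum_nonneg; intros y _; apply Rmult_le_pos; auto; apply Rle_0_sqr.
Qed.

Lemma energy_nonneg S g :
  NoDup S -> (forall x, ~ In x S -> g x = 0) -> 0 <= energy S g.
Proof.
  intros HS Hg; apply (energy_sum_le S [] g); auto; constructor.
Qed.

(** The derivative of the norm is [-2] times the energy. *)
Lemma norm2_decreasing S u s :
  NoDup S -> solS N q S u -> 0 <= s -> norm2 S (u s) <= norm2 S (u 0).
Proof.
  intros HS (Hu & Hu0) Hs.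
  apply (derive_nonpos_decreasing (fun r => norm2 S (u r))
    (fun r => - 2 * energy S (u r))); auto.
  - intros r _; unfold norm2; eapply is_derive_eq.
    + apply (is_derive_lsum S (fun x r => m x * (u r x * u r x))).
      intros x _; apply is_derive_scal, is_derive_Rmult; apply Hu.
    + unfold energy.
      replace (-2 * _) with (2 * lsum S (fun x => m x * (u r x * Lap N q (u r) x))) by ring.
      rewrite <- lsum_scal; apply lsum_ext; intros x Hx.
      rewrite LapS_in by auto; ring.
  - intros r _; pose proof (energy_nonneg S (u r) HS (Hu0 r)); lra.
Qed.

(** The derivative of the energy is [-2] times the squared norm of [LapS N q S (u r)]. *)
Lemma energy_decreasing S u s :
  NoDup S -> solS N q S u -> 0 <= s -> energy S (u s) <= energy S (u 0).
Proof.
  intros HS Hsol Hs; pose proof Hsol as (Hu & Hu0).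
  pose proof (solS_LapS N q S u Hsol) as (Hv & Hv0).
  apply (derive_nonpos_decreasing (fun r => energy S (u r))
    (fun r => - 2 * norm2 S (LapS N q S (u r)))); auto.
  - intros r _; unfold energy.
    apply (is_derive_Rext (fun r => -1 * lsum S (fun x => m x * (u r x * Lap N q (u r) x)))).
    { intros; ring. }
    eapply is_derive_eq.
    + apply is_derive_scal.
      apply (is_derive_lsum S (fun x r => m x * (u r x * Lap N q (u r) x))).
      intros x _; apply is_derive_scal, is_derive_Rmult; [apply Hu|].
      apply (is_derive_Lap N q u (fun r => LapS N q S (u r))); intros; apply Hu.
    + cbv beta.
      (* The two halves of the product rule agree because the Laplacian is symmetric on functions
         vanishing outside [S]. *)
      rewrite (lsum_ext S _ (fun x => m x * (LapS N q S (u r) x * Lap N q (u r) x) +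
        m x * (u r x * Lap N q (LapS N q S (u r)) x))) by (intros; ring).
      rewrite lsum_plus.
      rewrite (lsum_Lap_sym S (LapS N q S (u r)) (u r)) by auto.
      unfold norm2.
      rewrite (lsum_ext S (fun x => m x * (LapS N q S (u r) x * LapS N q S (u r) x))
        (fun x => m x * (LapS N q S (u r) x * Lap N q (u r) x))); [ring|].
      intros x Hx; rewrite !LapS_in by auto; ring.
  - intros r _.
    enough (0 <= norm2 S (LapS N q S (u r))) by lra.
    apply lsum_nonneg; intros; apply Rmult_le_pos; [left; auto|apply Rle_0_sqr].
Qed.

Lemma norm2_restrict L S g :
  NoDup L -> NoDup S -> incl L S -> (forall x, ~ In x L -> g x = 0) ->
  norm2 S g = norm2 L g.
Proof.
  intros HL HS HLS Hg; apply lsum_restrict; auto; intros; rewrite Hg; auto; ring.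
Qed.

Lemma energy_restrict L S g :
  NoDup L -> NoDup S -> incl L S -> (forall x, ~ In x L -> g x = 0) ->
  energy S g = energy L g.
Proof.
  intros HL HS HLS Hg; unfold energy; f_equal.
  apply lsum_restrict; auto; intros; rewrite Hg; auto; ring.
Qed.

Lemma solS_energy_bounds S u s K :
  NoDup S -> NoDup K -> solS N q S u -> 0 <= s ->
  lsum K (fun x => m x * (u s x * u s x + Gamma N q (u s) x)) <=
    norm2 S (u 0) + energy S (u 0).
Proof.
  intros HS HK Hu Hs.
  rewrite (lsum_ext K _ (fun x => m x * (u s x * u s x) + m x * Gamma N q (u s) x))
    by (intros; ring).
  rewrite lsum_plus; apply Rplus_le_compat.
  - eapply Rle_trans; [apply (norm2_sum_le S); auto; apply Hu|now apply norm2_decreasing].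
  - eapply Rle_trans; [apply (energy_sum_le S); auto; apply Hu|now apply energy_decreasing].
Qed.

(** With [w = LapS u], the derivative [2 u w + 2 Gamma(u, w)] is at most
    [(u^2 + Gamma u) + (w^2 + Gamma w)]. Each bracket at the single vertex [x] is at most its
    conserved bound divided by [m x >= c]. *)
Lemma solS_lipschitz S u c s r x :
  NoDup S -> solS N q S u -> 0 < c -> (forall y, c <= m y) -> 0 <= s -> 0 <= r ->
  let v := LapS N q S (u 0) in
  Rabs ((u s x * u s x + Gamma N q (u s) x) - (u r x * u r x + Gamma N q (u r) x)) <=
  (norm2 S (u 0) + energy S (u 0) + (norm2 S v + energy S v)) / c * Rabs (s - r).
Proof.
  intros HS Hu Hc Hcm Hs Hr v.
  pose proof (solS_LapS N q S u Hu) as Hv.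
  set (w := fun t => LapS N q S (u t)) in *.
  apply (derive_bound_lipschitz (fun t => u t x * u t x + Gamma N q (u t) x)
    (fun t => 2 * (u t x * w t x) + 2 * Gam N q 1 (u t) (w t) x)); auto.
  - intros t _; apply is_derive_Rplus.
    + eapply is_derive_eq; [apply is_derive_Rmult; apply Hu|unfold w; ring].
    + apply is_derive_Gamma; intros; apply Hu.
  - intros t Ht.
    assert (Hnd : NoDup [x]) by (constructor; [simpl; tauto|constructor]).
    pose proof (solS_energy_bounds S u t [x] HS Hnd Hu Ht) as B1.
    pose proof (solS_energy_bounds S w t [x] HS Hnd Hv Ht) as B2.
    simpl in B1, B2; rewrite Rplus_0_r in B1, B2.
    change (w 0) with v in B2.
    set (X := u t x * u t x + Gamma N q (u t) x) in *.
    set (Y := w t x * w t x + Gamma N q (w t) x) in *.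
    assert (HX : 0 <= X).
    { apply Rplus_le_le_0_compat; [apply Rle_0_sqr|now apply Gamma_nonneg]. }
    assert (HY : 0 <= Y).
    { apply Rplus_le_le_0_compat; [apply Rle_0_sqr|now apply Gamma_nonneg]. }
    apply Rle_trans with (X + Y).
    + eapply Rle_trans; [apply Rabs_triang|].
      pose proof (Gam1_bound N q Hq (u t) (w t) x).
      assert (Rabs (2 * (u t x * w t x)) <= u t x * u t x + w t x * w t x).
      { apply Rabs_le; split.
        - pose proof (Rle_0_sqr (u t x + w t x)); unfold Rsqr in *; lra.
        - pose proof (Rle_0_sqr (u t x - w t x)); unfold Rsqr in *; lra. }
      unfold X, Y; lra.
    + apply (Rmult_le_reg_r c); auto.
      unfold Rdiv; rewrite Rmult_assoc, Rinv_l by lra.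
      specialize (Hcm x); nra.
Qed.

End Energy.

(** * The limit semigroup *)

Lemma Un_cv_upper (u : nat -> R) (l B : R) (n0 : nat) :
  Un_cv u l -> (forall n, (n0 <= n)%nat -> u n <= B) -> l <= B.
Proof.
  intros Hu HB; apply Rnot_lt_le; intros Hlt.
  destruct (Hu (l - B)) as (n1 & Hn1); [lra|].
  specialize (Hn1 (max n0 n1) (Nat.le_max_r _ _)).
  specialize (HB (max n0 n1) (Nat.le_max_l _ _)).
  unfold Rdist in Hn1; apply Rabs_def2 in Hn1; lra.
Qed.

Lemma Un_cv_const (c : R) : Un_cv (fun _ => c) c.
Proof. apply is_lim_seq_Reals, is_lim_seq_const. Qed.

Lemma Un_cv_ext_from (u v : nat -> R) (l : R) (n0 : nat) :
  (forall n, (n0 <= n)%nat -> u n = v n) -> Un_cv u l -> Un_cv v l.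
Proof.
  intros E Hu e He; destruct (Hu e He) as (n1 & Hn1).
  exists (max n0 n1); intros n Hn; rewrite <- E by lia; apply Hn1; lia.
Qed.

Lemma Un_cv_lsum {V : Type} (l : list V) (a : V -> nat -> R) (L : V -> R) :
  (forall y, In y l -> Un_cv (a y) (L y)) ->
  Un_cv (fun n => lsum l (fun y => a y n)) (lsum l L).
Proof.
  induction l as [|z l IH]; simpl; intros H; [apply Un_cv_const|].
  apply (CV_plus (a z) (fun n => lsum l (fun y => a y n))); auto.
Qed.

Lemma Un_cv_scal (c : R) (u : nat -> R) (l : R) :
  Un_cv u l -> Un_cv (fun n => c * u n) (c * l).
Proof. intros H; apply (CV_mult (fun _ => c) u); auto using Un_cv_const. Qed.

Lemma Un_cv_Lap {V : Type} (N : V -> list V) q (u : nat -> V -> R) (g : V -> R) x :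
  (forall y, Un_cv (fun n => u n y) (g y)) ->
  Un_cv (fun n => Lap N q (u n) x) (Lap N q g x).
Proof.
  intros H; unfold Lap.
  apply (Un_cv_lsum (N x) (fun y n => q x y * (u n y - u n x))).
  intros y _; apply Un_cv_scal, CV_minus; auto.
Qed.

Lemma Un_cv_Gamma {V : Type} (N : V -> list V) q (u : nat -> V -> R) (g : V -> R) x :
  (forall y, Un_cv (fun n => u n y) (g y)) ->
  Un_cv (fun n => Gamma N q (u n) x) (Gamma N q g x).
Proof.
  intros H; rewrite Gamma_eq; unfold Rdiv; rewrite Rmult_comm.
  apply Un_cv_ext_from with (n0 := 0%nat) (u := fun n => / 2 *
    lsum (N x) (fun y => q x y * ((u n y - u n x) * (u n y - u n x)))).
  { intros n _; rewrite Gamma_eq; field. }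
  apply Un_cv_scal.
  apply (Un_cv_lsum (N x) (fun y n => q x y * ((u n y - u n x) * (u n y - u n x)))).
  intros y _; apply Un_cv_scal, CV_mult; apply CV_minus; auto.
Qed.

(** * Differentiability and continuity from quantitative increments, which survive pointwise
    limits *)

Lemma taylor_of_lipschitz_derivative (f df : R -> R) (C s r : R) :
  0 <= s -> 0 <= r ->
  (forall t, 0 <= t -> is_derive f t (df t)) ->
  (forall t, 0 <= t -> Rabs (df t - df r) <= C * Rabs (t - r)) ->
  Rabs (f s - f r - (s - r) * df r) <= C * (s - r) ^ 2.
Proof.
  intros Hs Hr Hd HL.
  assert (Hmin : 0 <= Rmin r s) by (apply Rmin_glb; auto).
  destruct (MVT_gen f r s df) as (c & Hc & ->).
  - intros x Hx; apply Hd; lra.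
  - intros x Hx; eapply is_derive_continuity_pt, Hd; lra.
  - replace (df c * (s - r) - (s - r) * df r) with ((df c - df r) * (s - r)) by ring.
    rewrite Rabs_mult, <- (pow2_abs (s - r)).
    assert (Hcr : Rabs (c - r) <= Rabs (s - r)).
    { unfold Rmin, Rmax, Rabs in *; repeat destruct Rle_dec; repeat destruct Rcase_abs; lra. }
    pose proof (HL s Hs) as HLs; specialize (HL c ltac:(lra)).
    pose proof (Rabs_pos (s - r)); pose proof (Rabs_pos (df s - df r)).
    destruct (Rle_lt_dec 0 C).
    + simpl; rewrite Rmult_1_r, <- Rmult_assoc; apply Rmult_le_compat_r; auto.
      eapply Rle_trans; [apply HL|now apply Rmult_le_compat_l].
    + replace (Rabs (s - r)) with 0 by nra; lra.
Qed.

Lemma is_derive_of_taylor (f : R -> R) (d C s : R) :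
  0 < s -> (forall t, 0 <= t -> Rabs (f t - f s - (t - s) * d) <= C * (t - s) ^ 2) ->
  is_derive f s d.
Proof.
  intros Hs Ht; apply is_derive_Reals; intros e He.
  set (C' := Rabs C + 1).
  assert (HC' : 0 < C') by (pose proof (Rabs_pos C); unfold C'; lra).
  assert (HCC : C <= C') by (pose proof (Rle_abs C); unfold C'; lra).
  (* The bound [s] keeps [s + h] in the half-line where the Taylor estimate is assumed. *)
  assert (Hdelta : 0 < Rmin s (e / C')).
  { apply Rmin_glb_lt; auto; apply Rdiv_lt_0_compat; auto. }
  exists (mkposreal _ Hdelta); intros h Hh0 Hh; simpl in Hh.
  assert (H1 : Rabs h < s) by (eapply Rlt_le_trans; [apply Hh|apply Rmin_l]).
  assert (H2 : Rabs h < e / C') by (eapply Rlt_le_trans; [apply Hh|apply Rmin_r]).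
  pose proof (Rabs_def2 _ _ H1).
  specialize (Ht (s + h) ltac:(lra)).
  replace (s + h - s) with h in Ht by ring.
  replace ((f (s + h) - f s) / h - d) with ((f (s + h) - f s - h * d) * / h) by (field; auto).
  rewrite Rabs_mult, Rabs_inv.
  assert (Hhp : 0 < Rabs h) by (apply Rabs_pos_lt; auto).
  apply (Rmult_lt_reg_r (Rabs h)); auto.
  rewrite Rmult_assoc, Rinv_l, Rmult_1_r by lra.
  eapply Rle_lt_trans; [apply Ht|].
  rewrite <- (pow2_abs h).
  apply (Rmult_lt_compat_r C') in H2; auto.
  unfold Rdiv in H2; rewrite Rmult_assoc, Rinv_l in H2 by lra.
  simpl; rewrite Rmult_1_r, <- Rmult_assoc; apply Rmult_lt_compat_r; auto; nra.
Qed.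

Lemma continuity_pt_of_lipschitz (f : R -> R) (C s : R) :
  (forall t, Rabs (f t - f s) <= C * Rabs (t - s)) -> continuity_pt f s.
Proof.
  intros H e He.
  set (C' := Rabs C + 1).
  assert (HC' : 0 < C') by (pose proof (Rabs_pos C); unfold C'; lra).
  assert (HCC : C <= C') by (pose proof (Rle_abs C); unfold C'; lra).
  exists (e / C'); split; [apply Rdiv_lt_0_compat; auto|].
  intros t [_ Ht]; simpl in *; unfold Rdist in *.
  eapply Rle_lt_trans; [apply H|].
  pose proof (Rabs_pos (t - s)).
  apply (Rmult_lt_compat_r C') in Ht; auto.
  unfold Rdiv in Ht; rewrite Rmult_assoc, Rinv_l in Ht by lra; nra.
Qed.

Section HeatLimit.
Context {V : Type} (N : V -> list V) (q : V -> V -> R) (Hq : forall x y, 0 <= q x y).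
Context (Ss : nat -> list V) (HSs : exhaustion Ss).
Implicit Types (f g : V -> R) (x y : V).

Lemma exhaustion_incl i j : (i <= j)%nat -> incl (Ss i) (Ss j).
Proof.
  induction 1 as [|j _ IH]; [apply incl_refl|].
  intros x Hx; apply (proj1 HSs), IH, Hx.
Qed.

Lemma exhaustion_list (L : list V) :
  exists i0, forall i, (i0 <= i)%nat -> incl L (Ss i).
Proof.
  induction L as [|a L (i0 & IH)].
  - exists 0%nat; intros i _ x [].
  - destruct (proj2 HSs a) as (i1 & Hi1).
    exists (max i0 i1); intros i Hi x [<-|Hx].
    + apply (exhaustion_incl i1); auto; lia.
    + apply (IH i); auto; lia.
Qed.

(* Frozen at its initial value for negative times, which keeps [s = 0] an interior
   point for continuity. *)
Definition heat f (s : R) x : R := lim_seq (fun i => heatS N q (Ss i) f (Rmax 0 s) x).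

Lemma heatS_nonneg S f s x :
  bounded_fn f -> (forall y, 0 <= f y) -> 0 <= s -> 0 <= heatS N q S f s x.
Proof.
  intros Hb Hf; apply (solS_nonneg N q Hq S); [now apply solS_heatS|].
  intros y _; rewrite heatS_0; pose proof (ind_bounds S y); specialize (Hf y); nra.
Qed.

Lemma heatS_abs S f B s x :
  (forall y, Rabs (f y) <= B) -> 0 <= s -> Rabs (heatS N q S f s x) <= B.
Proof.
  intros Hf; apply (solS_abs N q Hq S).
  - eapply Rle_trans; [apply Rabs_pos|apply (Hf x)].
  - apply solS_heatS; auto; exists B; auto.
  - intros y _; rewrite heatS_0; now apply cutoff_bound.
Qed.

Lemma heatS_mono S S' f g s x :
  bounded_fn f -> bounded_fn g -> incl S S' ->
  (forall y, 0 <= f y) -> (forall y, f y <= g y) -> 0 <= s ->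
  heatS N q S f s x <= heatS N q S' g s x.
Proof.
  intros Hf Hg Hincl Hpos Hfg.
  assert (Hpos' : forall y, 0 <= g y) by (intros y; apply Rle_trans with (f y); auto).
  apply (solS_mono N q Hq S S'); auto using solS_heatS.
  - intros y Hy; rewrite !heatS_0, !ind_in by auto; specialize (Hfg y); lra.
  - intros; now apply heatS_nonneg.
Qed.

Definition pos_part f x := Rmax (f x) 0.
Definition neg_part f x := Rmax (- f x) 0.

Lemma pos_part_nonneg f x : 0 <= pos_part f x.
Proof. apply Rmax_r. Qed.

Lemma neg_part_nonneg f x : 0 <= neg_part f x.
Proof. apply Rmax_r. Qed.

Lemma pos_part_bounded f : bounded_fn f -> bounded_fn (pos_part f).
Proof.
  intros (B & HB); exists B; intros x; specialize (HB x).
  unfold pos_part, Rmax, Rabs in *; destruct Rle_dec; repeat destruct Rcase_abs; lra.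
Qed.

Lemma neg_part_bounded f : bounded_fn f -> bounded_fn (neg_part f).
Proof.
  intros (B & HB); exists B; intros x; specialize (HB x).
  unfold neg_part, Rmax, Rabs in *; destruct Rle_dec; repeat destruct Rcase_abs; lra.
Qed.

Lemma pos_part_cutoff S f :
  pos_part (fun y => f y * ind S y) = fun y => pos_part f y * ind S y.
Proof.
  apply functional_extensionality; intros y; unfold pos_part, ind.
  destruct excluded_middle_informative; unfold Rmax; repeat destruct Rle_dec; lra.
Qed.

Lemma neg_part_cutoff S f :
  neg_part (fun y => f y * ind S y) = fun y => neg_part f y * ind S y.
Proof.
  apply functional_extensionality; intros y; unfold neg_part, ind.
  destruct excluded_middle_informative; unfold Rmax; repeat destruct Rle_dec; lra.
Qed.

Lemma heatS_parts S f s x : bounded_fn f -> 0 <= s ->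
  heatS N q S f s x = heatS N q S (pos_part f) s x - heatS N q S (neg_part f) s x.
Proof.
  intros Hf.
  apply (solS_unique N q Hq S _
    (fun s x => heatS N q S (pos_part f) s x - heatS N q S (neg_part f) s x)).
  - now apply solS_heatS.
  - apply solS_minus; apply solS_heatS; auto using pos_part_bounded, neg_part_bounded.
  - intros y _; rewrite !heatS_0; rewrite <- Rmult_minus_distr_r; f_equal.
    unfold pos_part, neg_part, Rmax; repeat destruct Rle_dec; lra.
Qed.

(** For nonnegative data the solutions increase with the domain and stay below the bound of the
    data; the general case is a difference of two such limits. *)
Lemma heatS_cv_exists f s x : bounded_fn f -> 0 <= s ->
  exists l, Un_cv (fun i => heatS N q (Ss i) f s x) l.
Proof.
  intros Hf Hs.
  assert (Hpos : forall g, bounded_fn g -> (forall y, 0 <= g y) ->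
    exists l, Un_cv (fun i => heatS N q (Ss i) g s x) l).
  { intros g Hg Hg0; pose proof Hg as (B & HB).
    destruct (ex_finite_lim_seq_incr (fun i => heatS N q (Ss i) g s x) B) as (l & Hl).
    - intros i; apply heatS_mono; auto; [|intros; lra].
      apply exhaustion_incl; lia.
    - intros i; eapply Rle_trans; [apply Rle_abs|now apply heatS_abs].
    - exists l; now apply is_lim_seq_Reals. }
  destruct (Hpos (pos_part f)) as (lp & Hlp); auto using pos_part_bounded, pos_part_nonneg.
  destruct (Hpos (neg_part f)) as (ln & Hln); auto using neg_part_bounded, neg_part_nonneg.
  exists (lp - ln).
  apply Un_cv_ext_from with (n0 := 0%nat) (2 := CV_minus _ _ _ _ Hlp Hln).
  intros i _; symmetry; now apply heatS_parts.
Qed.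

Lemma heat_cv f s x : bounded_fn f -> 0 <= s ->
  Un_cv (fun i => heatS N q (Ss i) f s x) (heat f s x).
Proof.
  intros Hf Hs; destruct (heatS_cv_exists f s x Hf Hs) as (l & Hl).
  unfold heat; rewrite Rmax_right by auto; rewrite (lim_seq_eq _ l); auto.
Qed.

Lemma heat_parts f s x : bounded_fn f -> 0 <= s ->
  heat f s x = heat (pos_part f) s x - heat (neg_part f) s x.
Proof.
  intros Hf Hs; eapply UL_sequence; [now apply heat_cv|].
  eapply Un_cv_ext_from with (n0 := 0%nat);
    [|apply CV_minus; apply heat_cv; auto using pos_part_bounded, neg_part_bounded].
  intros i _; symmetry; now apply heatS_parts.
Qed.

Lemma heat_0 f x : bounded_fn f -> heat f 0 x = f x.
Proof.
  intros Hf; eapply UL_sequence; [apply heat_cv; auto; lra|].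
  destruct (proj2 HSs x) as (i0 & Hi0).
  apply Un_cv_ext_from with (n0 := i0) (2 := Un_cv_const (f x)).
  intros i Hi; rewrite heatS_0, ind_in; [ring|].
  apply (exhaustion_incl i0); auto.
Qed.

Lemma heat_abs f B s x :
  (forall y, Rabs (f y) <= B) -> 0 <= s -> Rabs (heat f s x) <= B.
Proof.
  intros Hf Hs.
  apply (Un_cv_upper (fun i => Rabs (heatS N q (Ss i) f s x)) _ _ 0).
  - apply cv_cvabs, heat_cv; auto; exists B; auto.
  - intros i _; now apply heatS_abs.
Qed.

(** The bound depends on the rates at [x] alone and not on [S], so it survives the limit along the
    exhaustion. *)
Lemma heatS_LapS_bound S f B s x :
  (forall y, Rabs (f y) <= B) -> 0 <= s ->
  Rabs (LapS N q S (heatS N q S f s) x) <= 2 * B * lsum (N x) (q x).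
Proof.
  intros Hf Hs; unfold LapS.
  rewrite Rabs_mult; pose proof (ind_bounds S x).
  rewrite (Rabs_right (ind S x)) by lra.
  assert (H2 : Rabs (Lap N q (heatS N q S f s) x) <= 2 * B * lsum (N x) (q x))
    by (apply Lap_bound; auto; intros; now apply heatS_abs).
  pose proof (Rabs_pos (Lap N q (heatS N q S f s) x)); nra.
Qed.

Lemma heat_lipschitz f B s r x :
  (forall y, Rabs (f y) <= B) -> 0 <= s -> 0 <= r ->
  Rabs (heat f s x - heat f r x) <= 2 * B * lsum (N x) (q x) * Rabs (s - r).
Proof.
  intros Hf Hs Hr.
  assert (Hb : bounded_fn f) by (exists B; auto).
  apply (Un_cv_upper (fun i => Rabs (heatS N q (Ss i) f s x - heatS N q (Ss i) f r x)) _ _ 0).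
  - apply cv_cvabs, CV_minus; now apply heat_cv.
  - intros i _.
    apply (derive_bound_lipschitz (fun t => heatS N q (Ss i) f t x)
      (fun t => LapS N q (Ss i) (heatS N q (Ss i) f t) x)); auto.
    + intros; now apply heatS_derive.
    + intros; now apply heatS_LapS_bound.
Qed.

(** A second-order estimate for the finite sets whose constant involves only [x] and its neighbours
    passes to the limit. This avoids interchanging limit and derivative. *)
Lemma heat_taylor f B s r x :
  (forall y, Rabs (f y) <= B) -> 0 <= s -> 0 <= r ->
  Rabs (heat f s x - heat f r x - (s - r) * Lap N q (heat f r) x) <=
    lsum (N x) (fun y => q x y *
      (2 * B * lsum (N y) (q y) + 2 * B * lsum (N x) (q x))) * (s - r) ^ 2.
Proof.
  intros Hf Hs Hr.
  assert (Hb : bounded_fn f) by (exists B; auto).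
  destruct (exhaustion_list [x]) as (i0 & Hi0).
  apply (Un_cv_upper (fun i => Rabs (heatS N q (Ss i) f s x - heatS N q (Ss i) f r x
    - (s - r) * Lap N q (heatS N q (Ss i) f r) x)) _ _ i0).
  - apply cv_cvabs, CV_minus; [apply CV_minus; now apply heat_cv|].
    apply Un_cv_scal, Un_cv_Lap; intros; now apply heat_cv.
  - intros i Hi.
    assert (Hx : In x (Ss i)) by (apply (Hi0 i Hi); left; auto).
    rewrite <- (LapS_in N q (Ss i)) by auto.
    apply (taylor_of_lipschitz_derivative (fun t => heatS N q (Ss i) f t x)
      (fun t => LapS N q (Ss i) (heatS N q (Ss i) f t) x)); auto.
    { intros; now apply heatS_derive. }
    intros t Ht.
    (* The second time derivative at [x] is [Lap] of [LapS u], hence controlled by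
       [heatS_LapS_bound] at [x] and at its neighbours. *)
    pose proof (solS_LapS N q (Ss i) _ (solS_heatS N q Hq (Ss i) f Hb)) as (Hv & _).
    apply (derive_bound_lipschitz (fun t => LapS N q (Ss i) (heatS N q (Ss i) f t) x)
      (fun t => LapS N q (Ss i) (LapS N q (Ss i) (heatS N q (Ss i) f t)) x)); auto.
    intros a Ha; rewrite (LapS_in N q (Ss i)) by auto.
    eapply Rle_trans; [apply lsum_Rabs|]; apply lsum_le; intros y _.
    rewrite Rabs_mult, (Rabs_right (q x y)) by (apply Rle_ge; auto).
    apply Rmult_le_compat_l; auto.
    eapply Rle_trans; [apply Rabs_triang|]; rewrite Rabs_Ropp.
    apply Rplus_le_compat; now apply heatS_LapS_bound.
Qed.

Lemma heat_derive f s x : bounded_fn f -> 0 < s ->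
  is_derive (fun r => heat f r x) s (Lap N q (heat f s) x).
Proof.
  intros (B & HB) Hs.
  eapply is_derive_of_taylor; auto.
  intros t Ht; apply heat_taylor; auto; lra.
Qed.

Lemma heat_continuity f s x : bounded_fn f -> continuity_pt (fun r => heat f r x) s.
Proof.
  intros (B & HB).
  assert (HB0 : 0 <= B) by (eapply Rle_trans; [apply Rabs_pos|apply (HB x)]).
  apply continuity_pt_of_lipschitz with (2 * B * lsum (N x) (q x)).
  intros t.
  replace (heat f t x) with (heat f (Rmax 0 t) x)
    by (unfold heat; now rewrite (Rmax_right 0 (Rmax 0 t)) by apply Rmax_l).
  replace (heat f s x) with (heat f (Rmax 0 s) x)
    by (unfold heat; now rewrite (Rmax_right 0 (Rmax 0 s)) by apply Rmax_l).
  eapply Rle_trans; [apply heat_lipschitz; auto; apply Rmax_l|].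
  apply Rmult_le_compat_l.
  - apply Rmult_le_pos; [lra|apply lsum_nonneg; auto].
  - unfold Rmax, Rabs; repeat destruct Rle_dec; repeat destruct Rcase_abs; lra.
Qed.

Lemma IsHeat_heat f t Pf x :
  bounded_fn f -> 0 <= t -> IsHeat N q t f Pf -> Pf x = heat f t x.
Proof.
  intros Hf Ht HP; eapply UL_sequence; [apply (HP Ss HSs x)|].
  apply Un_cv_ext_from with (n0 := 0%nat) (2 := heat_cv f t x Hf Ht).
  intros i _; symmetry; now apply PS_heatS.
Qed.

(** A sandwich: [heatS] of [f] on [Ss k] lies below the full flow of the cut-off [f * ind (Ss k)],
    which lies below [heat f]; the lower end tends to [heat f]. *)
Lemma heat_cutoff_cv_nonneg f t x :
  bounded_fn f -> (forall y, 0 <= f y) -> 0 <= t ->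
  Un_cv (fun k => heat (fun y => f y * ind (Ss k) y) t x) (heat f t x).
Proof.
  intros Hf Hpos Ht; pose proof Hf as (B & HB).
  assert (Hfk : forall k, bounded_fn (fun y => f y * ind (Ss k) y)).
  { intros k; exists B; now apply cutoff_bound. }
  assert (Hfk0 : forall k y, 0 <= f y * ind (Ss k) y <= f y).
  { intros k y; pose proof (ind_bounds (Ss k) y); specialize (Hpos y); nra. }
  intros e He; destruct (heat_cv f t x Hf Ht e He) as (k0 & Hk0).
  exists k0; intros k Hk; specialize (Hk0 k Hk).
  assert (Hlow : heatS N q (Ss k) f t x <= heat (fun y => f y * ind (Ss k) y) t x).
  { enough (- heat (fun y => f y * ind (Ss k) y) t x <= - heatS N q (Ss k) f t x) by lra.
    apply (Un_cv_upper (fun i => - heatS N q (Ss i) (fun y => f y * ind (Ss k) y) t x) _ _ k).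
    - apply CV_opp; apply heat_cv; auto.
    - intros i Hi; apply Ropp_le_contravar.
      apply (solS_mono N q Hq (Ss k) (Ss i)); auto using solS_heatS.
      + apply exhaustion_incl; auto.
      + intros y Hy; rewrite !heatS_0, !ind_in; auto; [lra|].
        apply (exhaustion_incl k); auto.
      + intros; apply heatS_nonneg; auto; intros; apply Hfk0. }
  assert (Hup : heat (fun y => f y * ind (Ss k) y) t x <= heat f t x).
  { enough (heat (fun y => f y * ind (Ss k) y) t x - heat f t x <= 0) by lra.
    apply (Un_cv_upper (fun i => heatS N q (Ss i) (fun y => f y * ind (Ss k) y) t x
      - heatS N q (Ss i) f t x) _ _ 0).
    - apply CV_minus; apply heat_cv; auto.
    - intros i _; enough (heatS N q (Ss i) (fun y => f y * ind (Ss k) y) t x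
        <= heatS N q (Ss i) f t x) by lra.
      apply heatS_mono; auto using incl_refl; intros; apply Hfk0. }
  unfold Rdist in *; apply Rabs_def2 in Hk0; apply Rabs_def1; lra.
Qed.

Lemma heat_cutoff_cv f t x :
  bounded_fn f -> 0 <= t ->
  Un_cv (fun k => heat (fun y => f y * ind (Ss k) y) t x) (heat f t x).
Proof.
  intros Hf Ht; pose proof Hf as (B & HB).
  rewrite heat_parts by auto.
  eapply Un_cv_ext_from with (n0 := 0%nat);
    [|apply CV_minus; apply heat_cutoff_cv_nonneg;
      auto using pos_part_bounded, neg_part_bounded, pos_part_nonneg, neg_part_nonneg].
  intros k _; cbv beta.
  rewrite (heat_parts (fun y => f y * ind (Ss k) y)) by
    (auto; exists B; now apply cutoff_bound).
  now rewrite pos_part_cutoff, neg_part_cutoff.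
Qed.

End HeatLimit.

(** * The gradient estimate *)

Section GradientBound.
Context {V : Type} (N : V -> list V) (q : V -> V -> R) (m : V -> R).
Context (Hq : forall x y, 0 <= q x y) (HN : forall x y, In y (N x) <-> 0 < q x y).
Context (HNd : forall x, NoDup (N x)) (Hm : forall x, 0 < m x).
Context (Hrev : forall x y, q x y * m x = q y x * m y).
Context (Ss : nat -> list V) (HSs : exhaustion Ss) (HSd : forall i, NoDup (Ss i)).
Implicit Types (f g h : V -> R) (x y : V) (S L K : list V).

Lemma q_pos_sym x y : 0 < q x y -> 0 < q y x.
Proof.
  intros H; pose proof (Hrev x y) as E; pose proof (Hm x); pose proof (Hm y).
  apply Rnot_le_lt; intros Hle; nra.
Qed.

Lemma Lap_support L f x :
  (forall y, ~ In y L -> f y = 0) -> ~ In x (L ++ flat_map N L) -> Lap N q f x = 0.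
Proof.
  intros Hf Hx; rewrite in_app_iff in Hx.
  apply lsum_zero; intros y Hy; rewrite (Hf x), (Hf y); [ring| |tauto].
  intros HyL; apply Hx; right; apply in_flat_map; exists y; split; auto.
  now apply HN, q_pos_sym, HN.
Qed.

Lemma norm2_energy_ext S g h : (forall x, g x = h x) ->
  norm2 m S g + energy N q m S g = norm2 m S h + energy N q m S h.
Proof.
  intros E; unfold norm2, energy; f_equal; [|f_equal]; apply lsum_ext; intros x _.
  - now rewrite E.
  - rewrite (Lap_ext N q g h) by auto; now rewrite E.
Qed.

(** Once [Ss i] contains the supports of [f] and [Lap f], the initial norms and energies no longer
    depend on [i], so the finite estimates hold with fixed constants and pass to the limit. *)
Lemma heat_energy_bounds f c :
  fin_supp f -> bounded_fn f -> 0 < c -> (forall x, c <= m x) ->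
  let b s x := heat N q Ss f s x * heat N q Ss f s x + Gamma N q (heat N q Ss f s) x in
  exists C, (forall K s, NoDup K -> 0 <= s -> lsum K (fun x => m x * b s x) <= C) /\
    (forall s r x, 0 <= s -> 0 <= r -> Rabs (b s x - b r x) <= C * Rabs (s - r)).
Proof.
  intros (L & HL) Hf Hc Hcm b.
  destruct (nodup_list_exists (L ++ flat_map N L)) as (L' & HL' & HinL').
  assert (HfL' : forall x, ~ In x L' -> f x = 0).
  { intros x Hx; apply HL; intros H; apply Hx, HinL', in_app_iff; auto. }
  assert (HLapL' : forall x, ~ In x L' -> Lap N q f x = 0).
  { intros x Hx; apply (Lap_support L); auto; now rewrite <- HinL'. }
  destruct (exhaustion_list Ss HSs L') as (i0 & Hi0).
  set (C1 := norm2 m L' f + energy N q m L' f).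
  set (C2 := norm2 m L' (Lap N q f) + energy N q m L' (Lap N q f)).
  set (u := fun i => heatS N q (Ss i) f).
  assert (Hu : forall i, solS N q (Ss i) (u i))
    by (intros i; exact (solS_heatS N q Hq (Ss i) f Hf)).
  assert (Hu0 : forall i, (i0 <= i)%nat -> forall x, u i 0 x = f x).
  { intros i Hi x; unfold u; rewrite heatS_0.
    destruct (classic (In x (Ss i))) as [H|H]; [rewrite ind_in; auto; ring|].
    rewrite HfL'; [ring|intros Hx; apply H, (Hi0 i Hi), Hx]. }
  assert (E1 : forall i, (i0 <= i)%nat ->
    norm2 m (Ss i) (u i 0) + energy N q m (Ss i) (u i 0) = C1).
  { intros i Hi; rewrite (norm2_energy_ext _ _ f) by auto.
    rewrite (norm2_restrict m L'), (energy_restrict N q m L'); auto. }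
  assert (E2 : forall i, (i0 <= i)%nat ->
    norm2 m (Ss i) (LapS N q (Ss i) (u i 0)) +
    energy N q m (Ss i) (LapS N q (Ss i) (u i 0)) = C2).
  { intros i Hi; rewrite (norm2_energy_ext _ _ (Lap N q f)).
    - rewrite (norm2_restrict m L'), (energy_restrict N q m L'); auto.
    - intros x; destruct (classic (In x (Ss i))) as [H|H].
      + rewrite LapS_in by auto; now apply Lap_ext, Hu0.
      + rewrite LapS_notin, HLapL'; auto; intros Hx; apply H, (Hi0 i Hi), Hx. }
  assert (Hcv : forall s x, 0 <= s ->
    Un_cv (fun i => u i s x * u i s x + Gamma N q (u i s) x) (b s x)).
  { intros s x Hs.
    assert (Hy : forall y, Un_cv (fun i => u i s y) (heat N q Ss f s y))
      by (intros y; exact (heat_cv N q Hq Ss HSs f s y Hf Hs)).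
    apply CV_plus; [apply CV_mult; apply Hy|now apply Un_cv_Gamma]. }
  (* [C1] bounds the weighted sums and [(C1 + C2) / c] is the Lipschitz constant in time. *)
  exists (Rmax C1 ((C1 + C2) / c)); split.
  - intros K s HK Hs; eapply Rle_trans; [|apply Rmax_l].
    apply (Un_cv_upper (fun i => lsum K (fun x =>
      m x * (u i s x * u i s x + Gamma N q (u i s) x))) _ _ i0).
    + apply (Un_cv_lsum K (fun x i => m x * (u i s x * u i s x + Gamma N q (u i s) x))).
      intros x _; now apply Un_cv_scal, Hcv.
    + intros i Hi; rewrite <- (E1 i Hi); now apply solS_energy_bounds.
  - intros s r x Hs Hr.
    apply Rle_trans with ((C1 + C2) / c * Rabs (s - r)).
    2:{ apply Rmult_le_compat_r; [apply Rabs_pos|apply Rmax_r]. }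
    apply (Un_cv_upper (fun i => Rabs ((u i s x * u i s x + Gamma N q (u i s) x) -
      (u i r x * u i r x + Gamma N q (u i r) x))) _ _ i0).
    + apply cv_cvabs, CV_minus; now apply Hcv.
    + intros i Hi; rewrite <- (E1 i Hi), <- (E2 i Hi).
      now apply (solS_lipschitz N q m Hq HN HNd Hm Hrev).
Qed.

(** Chebyshev's inequality: each such vertex contributes at least [c * e] to a sum bounded by
    [C]. *)
Lemma summable_superlevel_finite (b : V -> R) (c C e : R) :
  0 < c -> (forall x, c <= m x) -> 0 < e ->
  (forall K, NoDup K -> lsum K (fun x => m x * b x) <= C) ->
  exists K, forall x, e <= b x -> In x K.
Proof.
  intros Hc Hcm He HC.
  assert (Hce : 0 < c * e) by (apply Rmult_lt_0_compat; auto).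
  destruct (INR_unbounded (C / (c * e))) as (n & Hn).
  apply (finite_of_bounded_nodup (fun x => e <= b x) n).
  intros l Hl Hlb; apply INR_le.
  assert (INR (length l) * (c * e) <= C).
  { eapply Rle_trans; [|apply (HC l Hl)]; apply lsum_const_le.
    intros x Hx; specialize (Hlb x Hx); specialize (Hcm x); nra. }
  apply (Rmult_lt_compat_r (c * e)) in Hn; auto.
  unfold Rdiv in Hn; rewrite Rmult_assoc, Rinv_l, Rmult_1_r in Hn by lra.
  apply (Rmult_le_reg_r (c * e)); auto; lra.
Qed.

(** The superlevel sets at the finitely many times of a grid on [[0,T]] are finite, and the
    Lipschitz bound covers the times between. *)
Lemma uniform_decay (b : R -> V -> R) (c C e T : R) :
  0 < c -> (forall x, c <= m x) -> 0 < e -> 0 <= T ->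
  (forall K s, NoDup K -> 0 <= s -> lsum K (fun x => m x * b s x) <= C) ->
  (forall s r x, 0 <= s -> 0 <= r -> Rabs (b s x - b r x) <= C * Rabs (s - r)) ->
  exists K, forall x s, ~ In x K -> 0 <= s <= T -> b s x <= e.
Proof.
  intros Hc Hcm He HT Hsum Hlip.
  set (C' := Rabs C + 1).
  assert (HC' : 0 < C') by (pose proof (Rabs_pos C); unfold C'; lra).
  assert (HCC : C <= C') by (pose proof (Rle_abs C); unfold C'; lra).
  (* Over one mesh width [b] changes by at most [e / 2], the margin left above the grid threshold
     [e / 2]. *)
  set (d := e / 2 / C').
  assert (Hd : 0 < d) by (apply Rdiv_lt_0_compat; lra).
  assert (Hgrid : forall n, exists K, forall j x, (j <= n)%nat ->
    e / 2 <= b (INR j * d) x -> In x K).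
  { assert (Hone : forall j, exists K, forall x, e / 2 <= b (INR j * d) x -> In x K).
    { intros j; apply (summable_superlevel_finite _ c C); auto; [lra|].
      intros K HK; apply Hsum; auto; apply Rmult_le_pos; [apply pos_INR|lra]. }
    induction n as [|n (K & IH)].
    - destruct (Hone 0%nat) as (K & HK); exists K; intros j x Hj.
      replace j with 0%nat by lia; auto.
    - destruct (Hone (Datatypes.S n)) as (K' & HK'); exists (K ++ K').
      intros j x Hj Hb; apply in_app_iff.
      destruct (Nat.eq_dec j (Datatypes.S n)) as [->|]; [right; auto|].
      left; apply (IH j); auto; lia. }
  destruct (nfloor_ex (T / d)) as (n & Hn1 & Hn2).
  { apply Rdiv_le_0_compat; lra. }
  destruct (Hgrid n) as (K & HK); exists K; intros x s Hx Hs.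
  destruct (nfloor_ex (s / d)) as (j & Hj1 & Hj2).
  { apply Rdiv_le_0_compat; lra. }
  assert (Hsd : s = s / d * d) by (field; lra).
  assert (Hjn : (j <= n)%nat).
  { apply Nat.lt_succ_r, INR_lt; rewrite S_INR.
    apply Rle_lt_trans with (s / d); auto; apply Rle_lt_trans with (T / d); auto.
    apply Rmult_le_compat_r; [left; now apply Rinv_0_lt_compat|lra]. }
  assert (Hbj : b (INR j * d) x <= e / 2).
  { apply Rnot_lt_le; intros Hlt; apply Hx, (HK j); auto; lra. }
  assert (Hclose : Rabs (s - INR j * d) <= d).
  { rewrite Hsd; apply Rabs_le; split; nra. }
  assert (Hjd : 0 <= INR j * d) by (apply Rmult_le_pos; [apply pos_INR|lra]).
  specialize (Hlip s (INR j * d) x ltac:(lra) Hjd).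
  assert (C * Rabs (s - INR j * d) <= e / 2).
  { pose proof (Rabs_pos (s - INR j * d)).
    apply Rle_trans with (C' * Rabs (s - INR j * d)); [nra|].
    replace (e / 2) with (C' * d) by (unfold d; field; lra).
    apply Rmult_le_compat_l; lra. }
  pose proof (Rle_abs (b s x - b (INR j * d) x)); lra.
Qed.

(** * The subsolution [u^2 + 2 s Gamma(u)] *)

Context (HCD : CD0 N q).

Definition bernstein f (s : R) x : R :=
  heat N q Ss f s x * heat N q Ss f s x + 2 * s * Gamma N q (heat N q Ss f s) x.

Definition dbernstein f (s : R) x : R :=
  2 * (heat N q Ss f s x * Lap N q (heat N q Ss f s) x) + 2 * Gamma N q (heat N q Ss f s) x
  + 2 * s * (2 * Gam N q 1 (heat N q Ss f s) (Lap N q (heat N q Ss f s)) x).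

Lemma bernstein_derive f s x : bounded_fn f -> 0 < s ->
  is_derive (fun r => bernstein f r x) s (dbernstein f s x).
Proof.
  intros Hf Hs.
  assert (Hu : forall y, is_derive (fun r => heat N q Ss f r y) s
    (Lap N q (heat N q Ss f s) y)) by (intros; now apply heat_derive).
  eapply is_derive_eq.
  - apply is_derive_Rplus.
    + apply is_derive_Rmult; apply Hu.
    + apply is_derive_Rmult.
      * apply is_derive_scal, (is_derive_id (s : R)).
      * apply (is_derive_Gamma N q (heat N q Ss f) (fun s => Lap N q (heat N q Ss f s))), Hu.
  - unfold dbernstein, one; simpl; ring.
Qed.

Lemma bernstein_continuity f s x : bounded_fn f ->
  continuity_pt (fun r => bernstein f r x) s.
Proof.
  intros Hf; unfold bernstein.
  assert (Hu : forall y, continuity_pt (fun r => heat N q Ss f r y) s)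
    by (intros; now apply heat_continuity).
  apply (continuity_pt_plus (fun r => heat N q Ss f r x * heat N q Ss f r x)
    (fun r => 2 * r * Gamma N q (heat N q Ss f r) x)).
  - apply (continuity_pt_mult (fun r => heat N q Ss f r x) (fun r => heat N q Ss f r x)); auto.
  - apply (continuity_pt_mult (fun r => 2 * r) (fun r => Gamma N q (heat N q Ss f r) x)).
    + apply continuity_pt_scal, continuity_pt_id.
    + now apply continuity_pt_Gamma.
Qed.

(** The terms [2 u Lap u + 2 Gamma u] occur on both sides; the difference that remains is
    [4 s Gamma2 u >= 0]. *)
Lemma bernstein_subsolution f s x : 0 <= s ->
  dbernstein f s x <= Lap N q (bernstein f s) x.
Proof.
  intros Hs; unfold bernstein; rewrite Lap_plus, Lap_sqr, Lap_scal.
  pose proof (HCD (heat N q Ss f s) x) as H; rewrite Gamma2_eq in H.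
  unfold dbernstein; fold (Gamma N q (heat N q Ss f s)) in *.
  nra.
Qed.

Lemma bernstein_0 f x : bounded_fn f -> bernstein f 0 x = f x * f x.
Proof. intros Hf; unfold bernstein; rewrite heat_0 by auto; ring. Qed.

Lemma sqr_le_of_abs (a M : R) : Rabs a <= M -> a * a <= M * M.
Proof.
  intros H; apply Rabs_le_between in H; nra.
Qed.

Lemma bernstein_bound_lower_measure f c M t x :
  fin_supp f -> (forall y, Rabs (f y) <= M) -> 0 < c -> (forall y, c <= m y) -> 0 <= t ->
  bernstein f t x <= M * M.
Proof.
  intros Hfin HM Hc Hcm Ht.
  assert (Hf : bounded_fn f) by (exists M; auto).
  apply le_epsilon; intros e He.
  destruct (heat_energy_bounds f c Hfin Hf Hc Hcm) as (C & Hsum & Hlip).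
  (* For [0 <= s <= t] the function is at most [(1 + 2 t) * (u^2 + Gamma u)], hence the tolerance
     [e / (1 + 2 t)]. *)
  destruct (uniform_decay _ c C (e / (1 + 2 * t)) t Hc Hcm
    ltac:(apply Rdiv_lt_0_compat; lra) Ht Hsum Hlip) as (K & HK).
  apply (max_principle N q Hq K t (M * M + e) (bernstein f) (dbernstein f)); try lra.
  - intros; now apply bernstein_continuity.
  - intros y s _ Hs; apply bernstein_derive; auto; lra.
  - intros y s _ Hs; apply bernstein_subsolution; lra.
  - intros y _; rewrite bernstein_0 by auto; pose proof (sqr_le_of_abs _ _ (HM y)); lra.
  - intros y s Hy Hs; specialize (HK y s Hy Hs); unfold bernstein; cbv beta in HK.
    pose proof (Gamma_nonneg N q Hq (heat N q Ss f s) y) as HG.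
    set (G := Gamma N q (heat N q Ss f s) y) in *.
    pose proof (Rle_0_sqr (heat N q Ss f s y)) as HU; unfold Rsqr in HU.
    set (U := heat N q Ss f s y * heat N q Ss f s y) in *.
    assert ((1 + 2 * t) * (U + G) <= e).
    { replace e with ((1 + 2 * t) * (e / (1 + 2 * t))) by (field; lra).
      apply Rmult_le_compat_l; lra. }
    pose proof (Rle_0_sqr M); unfold Rsqr in *; nra.
Qed.

(** * Distance to a vertex and the case of bounded degree *)

Lemma walk_ball_finite x0 n :
  exists L, forall x k, (k <= n)%nat -> walk q x x0 k -> In x L.
Proof.
  induction n as [|n (L & IH)].
  - exists [x0]; intros x k Hk Hw; replace k with 0%nat in Hw by lia.
    inversion Hw; subst; left; auto.
  - exists (x0 :: flat_map N L); intros x k Hk Hw.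
    inversion Hw as [|? y ? k' Hxy Hw']; subst; [left; auto|right].
    apply in_flat_map; exists y; split; [apply (IH y k'); auto; lia|].
    now apply HN, q_pos_sym.
Qed.

Lemma dist_exists (Hconn : g_connected q) x0 :
  exists psi : V -> nat, forall x, is_dist q x x0 (psi x).
Proof.
  assert (H : forall x, exists n, is_dist q x x0 n).
  { intros x; destruct (Hconn x x0) as (n & Hn).
    induction n as [n IH] using lt_wf_ind.
    destruct (classic (exists k, (k < n)%nat /\ walk q x x0 k)) as [(k & Hk & Hw)|Hno].
    - eapply IH; eauto.
    - exists n; split; auto; intros k Hw; apply Nat.nlt_ge; intros Hk; eauto. }
  exists (fun x => proj1_sig (constructive_indefinite_description _ (H x))).
  intros x; apply proj2_sig.
Qed.

Definition degree x : R :=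
  lsum (N x) (fun y => if excluded_middle_informative (y = x) then 0 else q x y).

Lemma Gamma_le_degree g M x :
  (forall y, Rabs (g y) <= M) -> Gamma N q g x <= 2 * (M * M) * degree x.
Proof.
  intros Hg; rewrite Gamma_eq; unfold degree.
  apply (Rmult_le_reg_r 2); [lra|]; unfold Rdiv; rewrite Rmult_assoc, Rinv_l, Rmult_1_r by lra.
  replace (2 * (M * M) * _ * 2) with (4 * (M * M) *
    lsum (N x) (fun y => if excluded_middle_informative (y = x) then 0 else q x y)) by ring.
  rewrite <- lsum_scal; apply lsum_le; intros y _.
  destruct excluded_middle_informative as [->|]; [right; ring|].
  rewrite Rmult_comm; apply Rmult_le_compat_r; auto.
  replace (4 * (M * M)) with ((2 * M) * (2 * M)) by ring.
  apply sqr_le_of_abs; unfold Rminus; eapply Rle_trans; [apply Rabs_triang|].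
  rewrite Rabs_Ropp; pose proof (Hg x); pose proof (Hg y); lra.
Qed.

(** The distance [p] to [x] grows by at most one along an edge, so [Lap p <= D] and the barrier
    [d * (D * s + p)] is a supersolution. Outside a large ball it absorbs the bound on [bernstein];
    then [d] tends to 0. *)
Lemma bernstein_bound_bounded_degree f D M t x :
  g_connected q -> (forall y, degree y <= D) -> (forall y, Rabs (f y) <= M) -> 0 <= t ->
  bernstein f t x <= M * M.
Proof.
  intros Hconn HD HM Ht.
  assert (Hf : bounded_fn f) by (exists M; auto).
  assert (HD0 : 0 <= D).
  { eapply Rle_trans; [|apply (HD x)]; apply lsum_nonneg; intros y _.
    destruct excluded_middle_informative; [lra|auto]. }
  destruct (dist_exists Hconn x) as (psi & Hpsi).
  set (p := fun y => INR (psi y)).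
  assert (Hp0 : forall y, 0 <= p y) by (intros; apply pos_INR).
  assert (HLap : forall y, Lap N q p y <= D).
  { intros y; eapply Rle_trans; [|apply (HD y)]; apply lsum_le; intros z Hz.
    destruct excluded_middle_informative as [->|_]; [right; ring|].
    apply HN in Hz.
    assert (Hle : (psi z <= Datatypes.S (psi y))%nat).
    { apply (Hpsi z); apply walkS with y; [now apply q_pos_sym|apply Hpsi]. }
    apply le_INR in Hle; rewrite S_INR in Hle; unfold p; nra. }
  assert (HB : forall y s, 0 <= s <= t -> bernstein f s y <= M * M + 4 * t * (M * M) * D).
  { intros y s Hs; unfold bernstein.
    assert (Hu : forall z, Rabs (heat N q Ss f s z) <= M) by (intros; apply heat_abs; auto; lra).
    pose proof (sqr_le_of_abs _ _ (Hu y)).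
    pose proof (Gamma_le_degree _ M y Hu) as HG.
    pose proof (Gamma_nonneg N q Hq (heat N q Ss f s) y) as HG0.
    assert (HMM : 0 <= M * M) by apply Rle_0_sqr.
    assert (Gamma N q (heat N q Ss f s) y <= 2 * (M * M) * D).
    { eapply Rle_trans; [apply HG|]; apply Rmult_le_compat_l; [lra|auto]. }
    assert (0 <= M * M * D) by (apply Rmult_le_pos; auto).
    apply Rplus_le_compat; auto.
    apply Rle_trans with (2 * t * Gamma N q (heat N q Ss f s) y); [nra|].
    replace (4 * t * (M * M) * D) with (2 * t * (2 * (M * M) * D)) by ring.
    apply Rmult_le_compat_l; lra. }
  apply le_epsilon; intros e He.
  (* Makes the barrier at time [t] and vertex [x] at most [e]. *)
  set (d := e / (D * t + p x + 1)).
  assert (HDt : 0 <= D * t) by (apply Rmult_le_pos; auto).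
  assert (Hd : 0 < d) by (apply Rdiv_lt_0_compat; auto; specialize (Hp0 x); lra).
  (* The radius [n] is chosen so that [d * n] exceeds the excess over [M * M] allowed by [HB]. *)
  destruct (INR_unbounded (4 * t * (M * M) * D / d)) as (n & Hn).
  destruct (walk_ball_finite x n) as (K & HK).
  enough (bernstein f t x - d * (D * t + p x) <= M * M).
  { assert (d * (D * t + p x) <= e); [|lra].
    replace e with (d * (D * t + p x + 1)) by (unfold d; field; specialize (Hp0 x); lra).
    apply Rmult_le_compat_l; lra. }
  apply (max_principle N q Hq K t (M * M)
    (fun s y => bernstein f s y - d * (D * s + p y))
    (fun s y => dbernstein f s y - d * D)); try lra.
  - intros y s _ _.
    apply (continuity_pt_minus (fun s => bernstein f s y) (fun s => d * (D * s + p y))).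
    + now apply bernstein_continuity.
    + apply continuity_pt_scal.
      apply (continuity_pt_plus (fun s => D * s) (fun _ => p y)).
      * apply continuity_pt_scal, continuity_pt_id.
      * apply continuity_pt_const; intros ? ?; reflexivity.
  - intros y s _ Hs; apply is_derive_Rminus; [apply bernstein_derive; auto; lra|].
    eapply is_derive_eq.
    + apply is_derive_scal, is_derive_Rplus;
        [apply is_derive_scal, (is_derive_id (s : R))|apply (is_derive_const (p y : R))].
    + unfold one, zero; simpl; ring.
  - intros y s _ Hs; rewrite Lap_minus, Lap_scal, Lap_plus.
    replace (Lap N q (fun _ => D * s) y) with 0
      by (symmetry; apply lsum_zero; intros; ring).
    pose proof (bernstein_subsolution f s y ltac:(lra)); specialize (HLap y); nra.
  - intros y _; rewrite bernstein_0 by auto.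
    pose proof (sqr_le_of_abs _ _ (HM y)); specialize (Hp0 y); nra.
  - intros y s Hy Hs; specialize (HB y s Hs).
    assert (Hpy : INR n <= p y).
    { apply le_INR, Nat.lt_le_incl, Nat.nle_gt; intros Hle.
      apply Hy, (HK y (psi y)); auto; apply Hpsi. }
    assert (4 * t * (M * M) * D <= d * p y).
    { replace (4 * t * (M * M) * D) with (d * (4 * t * (M * M) * D / d)) by (field; lra).
      apply Rmult_le_compat_l; lra. }
    assert (0 <= d * (D * s)) by (apply Rmult_le_pos; [lra|apply Rmult_le_pos; lra]).
    lra.
Qed.

(** A single edge satisfies [q x y * (u x - u y)^2 <= 2 Gamma u x], and [2 t Gamma u x] is part of
    [bernstein f t x]. *)
Lemma edge_bound_of_bernstein f M Q t x y :
  0 <= M -> 0 < t -> 0 < q x y -> Q <= q x y -> bernstein f t x <= M * M ->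
  Rabs (heat N q Ss f t x - heat N q Ss f t y) * sqrt (t * Q) <= M.
Proof.
  intros HM Ht Hxy HQ HF.
  destruct (Rle_lt_dec Q 0) as [HQ0|HQ0].
  (* [sqrt] is 0 on nonpositive arguments, so the claim reduces to [0 <= M]. *)
  { rewrite sqrt_neg_0 by nra; lra. }
  set (u := heat N q Ss f t) in *.
  set (d := u x - u y).
  rewrite <- (Rabs_right (sqrt (t * Q))) by (apply Rle_ge, sqrt_pos).
  rewrite <- Rabs_mult, <- (Rabs_right M) by lra.
  apply Rsqr_le_abs_0; rewrite Rsqr_mult, Rsqr_sqrt by (apply Rmult_le_pos; lra).
  assert (HG : q x y * (d * d) <= 2 * Gamma N q u x).
  { rewrite Gamma_eq.
    replace (2 * (_ / 2)) with
      (lsum (N x) (fun y => q x y * ((u y - u x) * (u y - u x)))) by field.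
    eapply Rle_trans; [|apply (lsum_term_le (N x)
      (fun y => q x y * ((u y - u x) * (u y - u x))) y)].
    - right; unfold d; ring.
    - intros; apply Rmult_le_pos; auto; apply Rle_0_sqr.
    - now apply HN. }
  unfold bernstein in HF; fold u in HF.
  pose proof (Rle_0_sqr (u x)); pose proof (Rle_0_sqr d); unfold Rsqr in *.
  apply Rle_trans with (t * (q x y * (d * d))).
  - replace (d * d * (t * Q)) with (t * (Q * (d * d))) by ring.
    apply Rmult_le_compat_l; [lra|]; apply Rmult_le_compat_r; auto.
  - apply Rle_trans with (t * (2 * Gamma N q u x)); [apply Rmult_le_compat_l|]; lra.
Qed.

(** With bounded degree [f] is treated directly. With a lower bound on [m] the estimate is applied
    to the cut-offs [f * ind (Ss k)], which keep the bound [M], and passed to the limit. *)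
Lemma heat_edge_bound f M Q t x y :
  g_connected q -> condA N q \/ (exists c, 0 < c /\ forall z, c <= m z) ->
  (forall z, Rabs (f z) <= M) -> 0 < t -> 0 < q x y -> Q <= q x y ->
  Rabs (heat N q Ss f t x - heat N q Ss f t y) * sqrt (t * Q) <= M.
Proof.
  intros Hconn Hcase HM Ht Hxy HQ.
  assert (HM0 : 0 <= M) by (eapply Rle_trans; [apply Rabs_pos|apply (HM x)]).
  destruct Hcase as [(D & HD)|(c & Hc & Hcm)].
  - apply edge_bound_of_bernstein; auto.
    apply bernstein_bound_bounded_degree with D; auto; lra.
  - assert (Hf : bounded_fn f) by (exists M; auto).
    apply (Un_cv_upper (fun k =>
      Rabs (heat N q Ss (fun z => f z * ind (Ss k) z) t x
        - heat N q Ss (fun z => f z * ind (Ss k) z) t y) * sqrt (t * Q)) _ _ 0).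
    + apply CV_mult; [|apply Un_cv_const].
      apply cv_cvabs, CV_minus; apply heat_cutoff_cv; auto; lra.
    + intros k _; apply edge_bound_of_bernstein; auto.
      apply bernstein_bound_lower_measure with c; auto; try lra.
      * exists (Ss k); intros z Hz; rewrite ind_notin by auto; ring.
      * now apply cutoff_bound.
Qed.

End GradientBound.

(** * From edges to paths, and the assembly of the theorem *)

Lemma walk_lipschitz {V : Type} (q : V -> V -> R) (u : V -> R) (c M : R) :
  (forall x y, 0 < q x y -> Rabs (u x - u y) * c <= M) -> 0 <= c ->
  forall x y n, walk q x y n -> Rabs (u x - u y) * c <= INR n * M.
Proof.
  intros H Hc x y n Hw; induction Hw as [x|x y z n Hxy Hw IH].
  - rewrite Rminus_diag, Rabs_R0; simpl; lra.
  - rewrite S_INR; specialize (H x y Hxy).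
    replace (u x - u z) with ((u x - u y) + (u y - u z)) by ring.
    pose proof (Rabs_triang (u x - u y) (u y - u z)); nra.
Qed.

(** The [n]-th set consists of the vertices with code below [n]; injectivity adds at most one vertex
    per step. *)
Lemma nodup_exhaustion_exists {V : Type} (enc : V -> nat) :
  (forall x y, enc x = enc y -> x = y) ->
  exists Ss : nat -> list V, exhaustion Ss /\ forall i, NoDup (Ss i).
Proof.
  intros Henc.
  assert (H : forall n, exists l : list V, NoDup l /\ forall x, In x l <-> (enc x < n)%nat).
  { induction n as [|n (l & Hnd & Hl)].
    - exists []; split; [constructor|intros x; simpl; lia].
    - destruct (classic (exists x, enc x = n)) as [(x & Hx)|Hno].
      + exists (x :: l); split.
        * constructor; auto; rewrite Hl; lia.
        * intros y; simpl; rewrite Hl; split.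
          -- intros [<-|]; lia.
          -- intros Hy; destruct (Nat.eq_dec (enc y) n); [left; apply Henc; lia|right; lia].
      + exists l; split; auto; intros y; rewrite Hl.
        assert (enc y <> n) by eauto; lia. }
  exists (fun n => proj1_sig (constructive_indefinite_description _ (H n))).
  assert (HS : forall n, let l := proj1_sig (constructive_indefinite_description _ (H n)) in
    NoDup l /\ forall x, In x l <-> (enc x < n)%nat) by (intros n; apply proj2_sig).
  repeat split.
  - intros i x; rewrite (proj2 (HS i)), (proj2 (HS (S i))); lia.
  - intros x; exists (S (enc x)); rewrite (proj2 (HS _)); lia.
  - intros i; apply HS.
Qed.

Theorem mainTheorem18 (V : Type) (q : V -> V -> R) (N : V -> list V) (m : V -> R)
  (enc : V -> nat)
  (Henc : forall x y, enc x = enc y -> x = y)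
  (Hq : forall x y, 0 <= q x y)
  (HN : forall x y, In y (N x) <-> 0 < q x y)
  (HNd : forall x, NoDup (N x))
  (Hm : forall x, 0 < m x)
  (Hrev : forall x y, q x y * m x = q y x * m y)
  (Hconn : g_connected q)
  (HCD : CD0 N q)
  (Hcond : condA N q \/ condB N q m \/ condC q m) :
  (forall f : V -> R, (forall x, 0 <= f x) -> fin_supp f ->
     forall t, 0 < t -> heat_grad_bound N q f t) /\
  (condA N q \/ condB N q m ->
     forall f : V -> R, bounded_fn f -> forall t, 0 < t -> heat_grad_bound N q f t).
Proof.
  destruct (nodup_exhaustion_exists enc Henc) as (Ss & HSs & HSd).
  (* Both halves are instances of one bound, in which the supremum norm [M] supplies the boundedness
     of [f]. *)
  enough (Hall : forall f t, 0 < t -> heat_grad_bound N q f t) by (split; auto).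
  intros f t Ht Pf HPf M (HM & _) Q (HQ & _) x y n Hxy (Hw & _).
  assert (HfM : forall z, Rabs (f z) <= M) by (intros z; apply HM; eauto).
  assert (HM0 : 0 <= M) by (eapply Rle_trans; [apply Rabs_pos|apply (HfM x)]).
  destruct (Rle_lt_dec Q 0) as [HQ0|HQ0].
  { rewrite sqrt_neg_0 by nra; lra. }
  assert (Hcase : condA N q \/ (exists c, 0 < c /\ forall z, c <= m z)).
  { destruct Hcond as [HA|[((c & Hc) & _)|HC]]; [left; auto|right; eauto|right].
    exists Q; split; auto; intros z.
    (* Under (C): one of [x], [y] differs from [z], so a walk from [z] to it starts with some edge;
       the reversed edge has rate at least [Q] and at most [m z]. *)
    assert (Hz : exists z', z <> z').
    { destruct (classic (z = x)) as [->|]; eauto. }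
    destruct Hz as (z' & Hz'); destruct (Hconn z z') as (k & Hk).
    inversion Hk as [|? y' ? ? Hzy]; subst; [tauto|].
    apply Rle_trans with (q y' z); [|apply HC].
    apply HQ; now apply (q_pos_sym q m Hm Hrev). }
  assert (Hn : 0 < INR n).
  { apply lt_0_INR; destruct n; [inversion Hw; subst; tauto|lia]. }
  assert (Hwalk : Rabs (Pf x - Pf y) * sqrt (t * Q) <= INR n * M).
  { rewrite !(IsHeat_heat N q Hq Ss HSs f t Pf); auto; try lra; try (exists M; auto; fail).
    apply (walk_lipschitz q (heat N q Ss f t)); auto using sqrt_pos.
    intros a b Hab; apply (heat_edge_bound N q m); auto. }
  apply (Rmult_le_reg_l (INR n)); auto.
  replace (INR n * _) with (Rabs (Pf x - Pf y) * sqrt (t * Q)) by (field; lra); auto.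
Qed.
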